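(* Let $G=\mathfrak{S}H$ be a quantum group scheme. (i) There is a canonical functor $\mathfrak{M}^\dag:G/\mathbf{S}_{\mathrm{fnt}}^{\mathrm{op}}\times G/\mathbf{S}\to\mathbf{S}$, induced on the opposite categories by the functor $\mathfrak{A}^\dag:H/\mathbf{M}\times H/\mathbf{M}_{\mathrm{fd}}^{\mathrm{op}}\to\mathbf{A}$, such that for all $S_1\in G/\mathbf{S}_{\mathrm{fnt}}$, $S_2\in G/\mathbf{S}$ there is a natural bijection between the set of $G$-mappings from $S_1$ to $S_2$ and the set of points of $\mathfrak{M}^\dag(S_1,S_2)$. (ii) There is a canonical functor $\mathfrak{M}^\dag:G/\mathbf{S}^{\mathrm{op}}\times G/\mathbf{S}_{\mathrm{fd}}\to\mathbf{indS}_{\mathrm{fd}}$, induced on the opposite categories by the functor $\mathfrak{A}^\dag:H/\mathbf{M}_{\mathrm{fg}}\times H/\mathbf{M}^{\mathrm{op}}\to\mathbf{proA}_{\mathrm{fg}}$, such that for all $S_1\in G/\mathbf{S}$, $S_2\in G/\mathbf{S}_{\mathrm{fd}}$ there is a natural bijection between the set of $G$-mappings from $S_1$ to $S_2$ and the set of points of $\mathfrak{M}^\dag(S_1,S_2)$.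
   Context: Fix a field $\mathbb{K}$; algebras and tensor products are over $\mathbb{K}$. $\mathbf{A}$ is the category of unital associative (not necessarily commutative) algebras with unit-preserving morphisms, $\mathbf{A}_{\mathrm{fg}}$ its full subcategory of finitely generated algebras. For a category $\mathbf{C}$, $\mathbf{proC}$ is the category of pro-objects (inverse systems in $\mathbf{C}$ indexed by directed sets) with $\mathbf{proC}(C,D)=\varprojlim_j\varinjlim_i\mathbf{C}(C_i,D_j)$; objects of $\mathbf{C}$ are pro-objects over a one-element index set. For pro-algebras, $(A\otimes B)_{(i,j)}=A_i\otimes B_j$ with the evident transition maps. $\mathbf{S}:=\mathbf{A}^{\mathrm{op}}$ (schemes), $\mathbf{indS}_{\mathrm{fd}}:=\mathbf{proA}_{\mathrm{fg}}^{\mathrm{op}}$; quantum group schemes are the objects of the opposite of the category of Hopf algebras; $\mathfrak{S}$ denotes the renaming duality functor to opposite categories. A point of $\mathfrak{S}A$ is an algebra morphism $A\to\mathbb{K}$ when $A$ is an algebra, and a pro-morphism $A\to\mathbb{K}$ when $A$ is a pro-algebra. Let $H$ be a Hopf algebra with comultiplication $\Delta$ and counit $\epsilon$, and $G=\mathfrak{S}H$. An $H$-comodule is an algebra $V$ with a coaction, i.e. an algebra morphism $\rho:V\to V\otimes H$ with $(\rho\otimes\mathrm{id}_H)\rho=(\mathrm{id}_V\otimes\Delta)\rho$ and $(\mathrm{id}_V\otimes\epsilon)\rho=\mathrm{id}_V$. $H/\mathbf{M}$ is the category of $H$-comodules with algebra morphisms respecting coactions; $H/\mathbf{M}_{\mathrm{fd}}$,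 $H/\mathbf{M}_{\mathrm{fg}}$ are the full subcategories of those with finite dimensional, respectively finitely generated, underlying algebra. $G/\mathbf{S}:=H/\mathbf{M}^{\mathrm{op}}$ is the category of $G$-schemes, whose morphisms are called $G$-mappings; $G/\mathbf{S}_{\mathrm{fnt}}:=H/\mathbf{M}_{\mathrm{fd}}^{\mathrm{op}}$ and $G/\mathbf{S}_{\mathrm{fd}}:=H/\mathbf{M}_{\mathrm{fg}}^{\mathrm{op}}$. For $V,W\in H/\mathbf{M}$ with coactions $\rho,\varrho$, a (pro-)family of $H$-comodule morphisms from $W$ to $V$ is a (pro-)algebra $U$ with a (pro-)algebra morphism $\phi:W\to V\otimes U$ satisfying $(\mathrm{id}_V\otimes F)(\rho\otimes\mathrm{id}_U)\phi=(\phi\otimes\mathrm{id}_H)\varrho$, with $F$ the flip. The functors $\mathfrak{A}^\dag$ (in (i) with values in $\mathbf{A}$, in (ii) with values in $\mathbf{proA}_{\mathrm{fg}}$) are those that come with natural (pro-)families $\mathfrak{h}^\dag(W,V):W\to V\otimes\mathfrak{A}^\dag(W,V)$ of $H$-comodule morphisms, where naturality means $(\mathrm{id}\otimes\mathfrak{A}^\dag(g,f))\mathfrak{h}^\dag(W,V)=(f\otimes\mathrm{id})\mathfrak{h}^\dag(W',V')g$ for $g:W\to W'$, $f:V'\to V$, and that are characterized by the universal property: every (pro-)family $\phi:W\to V\otimes U$ of $H$-comodule morphisms from $W$ to $V$ equals $(\mathrm{id}_V\otimes\hat\phi)\mathfrak{h}^\dag(W,V)$ for a unique (pro-)morphism $\hat\phi:\mathfrak{A}^\dag(W,V)\to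 U$. Thus $\mathfrak{M}^\dag(\mathfrak{S}V,\mathfrak{S}W)=\mathfrak{S}\mathfrak{A}^\dag(W,V)$. *)

(* Defs.v *)
From HB Require Import structures.
From mathcomp Require Import all_boot all_order all_algebra.
From mathcomp Require Import boolp.

Set Implicit Arguments.
Unset Strict Implicit.
Unset Printing Implicit Defensive.

Import GRing.Theory.
Local Open Scope ring_scope.
Local Open Scope quotient_scope.

Definition bilinear_map (K : fieldType) (M N P : lmodType K)
    (f : M -> N -> P) : Prop :=
  (forall m, linear (f m)) /\ (forall n, linear (f^~ n)).

Section Tensor.
Variables (K : fieldType) (M N : lmodType K).
Implicit Types (P : lmodType K) (s t : seq (M * N)).

Definition formal_eval P (f : M -> N -> P) s : P := \sum_(p <- s) f p.1 p.2.

(* [s] represents \sum_(p <- s) p.1 ⊗ p.2. Two formal sums are identified when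
   no bilinear map distinguishes them; the universal property of the quotient
   [tens] is given by [tens_lift_linear], [tens_lift_pure] and
   [tens_linear_eq]. *)
Definition tens_rel s t : bool :=
  `[< forall P (f : M -> N -> P), bilinear_map f ->
        formal_eval f s = formal_eval f t >].

Lemma tens_rel_refl : reflexive tens_rel.
Proof. by move=> s; apply/asboolP. Qed.

Lemma tens_rel_sym : symmetric tens_rel.
Proof.
by move=> s t; apply/asboolP/asboolP => e P f bf; rewrite e.
Qed.

Lemma tens_rel_trans : transitive tens_rel.
Proof.
move=> t s u /asboolP e1 /asboolP e2; apply/asboolP => P f bf.
by rewrite e1 // e2.
Qed.

Canonical tens_equiv : equiv_rel _ :=
  EquivRel tens_rel tens_rel_refl tens_rel_sym tens_rel_trans.

Definition tens : Type := {eq_quot tens_equiv}.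

HB.instance Definition _ := Quotient.on tens.
HB.instance Definition _ := Choice.on tens.

Implicit Types x y z : tens.

Definition tens_pure (m : M) (n : N) : tens := \pi_tens [:: (m, n)].

Definition tens_lift P (f : M -> N -> P) x : P := formal_eval f (repr x).

Lemma tens_lift_pi P (f : M -> N -> P) s :
  bilinear_map f -> tens_lift f (\pi_tens s) = formal_eval f s.
Proof.
move=> bf; rewrite /tens_lift.
have : \pi_tens (repr (\pi_tens s)) = \pi_tens s by rewrite reprK.
by move=> /eqmodP/asboolP; apply.
Qed.

Lemma tens_piP s t :
  (forall P (f : M -> N -> P), bilinear_map f ->
     formal_eval f s = formal_eval f t) -> \pi_tens s = \pi_tens t.
Proof. by move=> e; apply/eqmodP/asboolP. Qed.

Lemma tens_sep x y :
  (forall P (f : M -> N -> P), bilinear_map f -> tens_lift f x = tens_lift f y)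
  -> x = y.
Proof.
move=> e; rewrite -(reprK x) -(reprK y); apply: tens_piP => P f bf.
by have := e P f bf.
Qed.

Definition tens_zero : tens := \pi_tens [::].
Definition tens_add x y : tens := \pi_tens (repr x ++ repr y).
Definition tens_scale (k : K) x : tens :=
  \pi_tens [seq (k *: p.1, p.2) | p <- repr x].
Definition tens_opp x : tens := tens_scale (-1) x.

Lemma tens_lift0 P (f : M -> N -> P) :
  bilinear_map f -> tens_lift f tens_zero = 0.
Proof. by move=> bf; rewrite tens_lift_pi // /formal_eval big_nil. Qed.

Lemma tens_liftD P (f : M -> N -> P) x y : bilinear_map f ->
  tens_lift f (tens_add x y) = tens_lift f x + tens_lift f y.
Proof. by move=> bf; rewrite tens_lift_pi // /formal_eval big_cat. Qed.

Lemma bilin_scalel P (f : M -> N -> P) k m n : bilinear_map f ->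
  f (k *: m) n = k *: f m n.
Proof.
move=> [_ /(_ n) lf]; have f0 : f 0 n = 0.
  have := lf 1 0 0; rewrite scale1r addr0 /= scale1r => /eqP.
  by rewrite -subr_eq subrr => /eqP.
by have := lf k m 0; rewrite !addr0 f0 addr0.
Qed.

Lemma bilin_scaler P (f : M -> N -> P) k m n : bilinear_map f ->
  f m (k *: n) = k *: f m n.
Proof.
move=> [/(_ m) lf _]; have f0 : f m 0 = 0.
  have := lf 1 0 0; rewrite scale1r addr0 scale1r => /eqP.
  by rewrite -subr_eq subrr => /eqP.
by have := lf k n 0; rewrite !addr0 f0 addr0.
Qed.

Lemma tens_liftZ P (f : M -> N -> P) k x : bilinear_map f ->
  tens_lift f (tens_scale k x) = k *: tens_lift f x.
Proof.
move=> bf; rewrite tens_lift_pi // /formal_eval big_map scaler_sumr.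
by apply: eq_bigr => p _; rewrite bilin_scalel.
Qed.

Lemma tens_liftN P (f : M -> N -> P) x : bilinear_map f ->
  tens_lift f (tens_opp x) = - tens_lift f x.
Proof. by move=> bf; rewrite tens_liftZ // scaleN1r. Qed.

Definition tens_liftE :=
  (tens_lift0, tens_liftD, tens_liftZ, tens_liftN).

Lemma tens_addA : associative tens_add.
Proof.
by move=> x y z; apply: tens_sep => P f bf; rewrite !tens_liftE // addrA.
Qed.
Lemma tens_addC : commutative tens_add.
Proof.
by move=> x y; apply: tens_sep => P f bf; rewrite !tens_liftE // addrC.
Qed.
Lemma tens_add0 : left_id tens_zero tens_add.
Proof.
by move=> x; apply: tens_sep => P f bf; rewrite !tens_liftE // add0r.
Qed.
Lemma tens_addN : left_inverse tens_zero tens_opp tens_add.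
Proof.
by move=> x; apply: tens_sep => P f bf; rewrite !tens_liftE // addNr.
Qed.

HB.instance Definition _ :=
  GRing.isZmodule.Build tens tens_addA tens_addC tens_add0 tens_addN.

Lemma tens_scaleA a b x : tens_scale a (tens_scale b x) = tens_scale (a * b) x.
Proof.
by apply: tens_sep => P f bf; rewrite !tens_liftE // scalerA.
Qed.
Lemma tens_scale1 : left_id 1 tens_scale.
Proof.
by move=> x; apply: tens_sep => P f bf; rewrite !tens_liftE // scale1r.
Qed.
Lemma tens_scaleDr : right_distributive tens_scale +%R.
Proof.
by move=> k x y; apply: tens_sep => P f bf; rewrite !tens_liftE // scalerDr.
Qed.
Lemma tens_scaleDl x : {morph tens_scale^~ x : a b / a + b}.
Proof.
by move=> a b; apply: tens_sep => P f bf; rewrite !tens_liftE // scalerDl.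
Qed.

HB.instance Definition _ := GRing.Zmodule_isLmodule.Build K tens
  tens_scaleA tens_scale1 tens_scaleDr tens_scaleDl.

Lemma tens_pure_bilinear : bilinear_map tens_pure.
Proof.
split=> [m k n n'|n k m m']; apply: tens_sep => P f bf;
  rewrite !tens_liftE // !tens_lift_pi // /formal_eval !big_seq1 /=.
- by case: bf => + _; apply.
- by case: bf => _; apply.
Qed.

Lemma tens_lift_linear P (f : M -> N -> P) :
  bilinear_map f -> linear (tens_lift f).
Proof. by move=> bf k x y; rewrite !tens_liftE. Qed.

Lemma tens_lift_pure P (f : M -> N -> P) m n :
  bilinear_map f -> tens_lift f (tens_pure m n) = f m n.
Proof. by move=> bf; rewrite tens_lift_pi // /formal_eval big_seq1. Qed.

Lemma tens_lift_comb P (f g h : M -> N -> P) k x :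
  (forall m n, f m n = k *: g m n + h m n) ->
  tens_lift f x = k *: tens_lift g x + tens_lift h x.
Proof.
move=> e; rewrite /tens_lift /formal_eval scaler_sumr -big_split.
by apply: eq_bigr => p _; rewrite e.
Qed.

Lemma tens_ind (Q : tens -> Prop) :
  (forall m n, Q (tens_pure m n)) -> (forall x y, Q x -> Q y -> Q (x + y)) ->
  forall x, Q x.
Proof.
move=> Qp QD x; rewrite -(reprK x); elim: (repr x) => [|[m n] s IH].
  suff -> : \pi_tens [::] = tens_pure 0 0 by [].
  apply: tens_sep => P f bf; rewrite tens_lift_pure // tens_lift0 //.
  by have := bilin_scalel 0 0 0 bf; rewrite !scale0r.
suff -> : \pi_tens ((m, n) :: s) = tens_pure m n + \pi_tens s by apply: QD.
apply: tens_sep => P f bf; rewrite tens_liftD // tens_lift_pure //.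
by rewrite !tens_lift_pi // /formal_eval big_cons.
Qed.

Lemma tens_linear_eq P (f g : tens -> P) : linear f -> linear g ->
  (forall m n, f (tens_pure m n) = g (tens_pure m n)) -> f =1 g.
Proof.
move=> lf lg e; apply: tens_ind => // x y ex ey.
by have := lf 1 x y; have := lg 1 x y; rewrite !scale1r ex ey => -> ->.
Qed.

End Tensor.

(* [algType K] excludes the zero algebra, which is an object of the category of
   unital associative algebras (and may be the value of the functors below). *)
Record algebra (K : fieldType) := Algebra {
  alg_lmod : lmodType K;
  alg_one : alg_lmod;
  alg_mul : alg_lmod -> alg_lmod -> alg_lmod;
  alg_mulA : associative alg_mul;
  alg_mul1 : left_id alg_one alg_mul;
  alg_1mul : right_id alg_one alg_mul;
  alg_mul_bilinear : bilinear_map alg_mul }.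

Definition alg_sort (K : fieldType) (A : algebra K) : Type := alg_lmod A.
Coercion alg_sort : algebra >-> Sortclass.

HB.instance Definition _ (K : fieldType) (A : algebra K) :=
  GRing.Lmodule.copy (alg_sort A) (alg_lmod A).

Section AlgebraRing.
Variables (K : fieldType) (A : algebra K).
Implicit Types x y z : A.

Let mul : A -> A -> A := @alg_mul K A.

Lemma alg_mulDl : left_distributive mul +%R.
Proof.
move=> x y z; have [_ /(_ z 1 x y)] := alg_mul_bilinear A.
by rewrite !scale1r.
Qed.
Lemma alg_mulDr : right_distributive mul +%R.
Proof.
move=> x y z; have [/(_ x 1 y z) + _] := alg_mul_bilinear A.
by rewrite !scale1r.
Qed.

HB.instance Definition _ := GRing.Zmodule_isPzRing.Build (alg_sort A)
  (@alg_mulA K A) (@alg_mul1 K A) (@alg_1mul K A) alg_mulDl alg_mulDr.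

Lemma alg_scaleAl (k : K) x y : k *: (x * y) = (k *: x) * y.
Proof. by rewrite -(bilin_scalel k x y (alg_mul_bilinear A)). Qed.

Lemma alg_scaleAr (k : K) x y : k *: (x * y) = x * (k *: y).
Proof. by rewrite -(bilin_scaler k x y (alg_mul_bilinear A)). Qed.

End AlgebraRing.

Record alg_hom (K : fieldType) (A B : algebra K) := AlgHom {
  alg_fun :> A -> B;
  alg_hom_linear : linear alg_fun;
  alg_hom_monoid : monoid_morphism alg_fun }.

HB.instance Definition _ (K : fieldType) (A B : algebra K) (f : alg_hom A B) :=
  GRing.isLinear.Build K A B *:%R (alg_fun f) (alg_hom_linear f).
HB.instance Definition _ (K : fieldType) (A B : algebra K) (f : alg_hom A B) :=
  GRing.isMonoidMorphism.Build A B (alg_fun f) (alg_hom_monoid f).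

Section AlgHom.
Variable K : fieldType.
Implicit Types A B C : algebra K.

Lemma alg_homP A B (f g : alg_hom A B) : f =1 g -> f = g.
Proof.
case: f g => [f lf mf] [g lg mg] /= /funext e; move: lg mg; rewrite -e => lg mg.
by rewrite (Prop_irrelevance lf lg) (Prop_irrelevance mf mg).
Qed.

Definition alg_id A : alg_hom A A :=
  @AlgHom K A A id (fun _ _ _ => erefl) (conj erefl (fun _ _ => erefl)).

Lemma alg_comp_linear A B C (g : alg_hom B C) (f : alg_hom A B) :
  linear (g \o f).
Proof. by move=> k x y; rewrite /= !linearP. Qed.
Lemma alg_comp_monoid A B C (g : alg_hom B C) (f : alg_hom A B) :
  monoid_morphism (g \o f).
Proof. by split=> [|x y]; rewrite /= ?rmorph1 ?rmorphM. Qed.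
Definition alg_comp A B C (g : alg_hom B C) (f : alg_hom A B) : alg_hom A C :=
  AlgHom (alg_comp_linear g f) (alg_comp_monoid g f).

Lemma alg_compE A B C (g : alg_hom B C) (f : alg_hom A B) a :
  alg_comp g f a = g (f a).
Proof. by []. Qed.

End AlgHom.

Section Ground.
Variable K : fieldType.

Lemma ground_bilinear : @bilinear_map K K^o K^o K^o *%R.
Proof.
split=> [x k y z|z k x y] /=; first by rewrite mulrDr scalerAr.
by rewrite mulrDl scalerAl.
Qed.

Definition ground : algebra K :=
  @Algebra K K^o 1 *%R (@mulrA K) (@mul1r K) (@mulr1 K) ground_bilinear.

End Ground.

Section TensAlg.
Variable K : fieldType.
Implicit Types A B C : algebra K.

Section Mul.
Variables A B : algebra K.
Implicit Types x y z : tens A B.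

Let mul_pure (a : A) (b : B) (a' : A) (b' : B) : tens A B :=
  tens_pure (a * a') (b * b').

Definition tens_mul x y : tens A B :=
  tens_lift (fun a b => tens_lift (mul_pure a b) y) x.

Let pureDl k (a a' : A) (b : B) : tens_pure (k *: a + a') b =
  k *: tens_pure a b + tens_pure a' b.
Proof. by have [_ ->] := @tens_pure_bilinear K A B. Qed.
Let pureDr k (a : A) (b b' : B) : tens_pure a (k *: b + b') =
  k *: tens_pure a b + tens_pure a b'.
Proof. by have [-> _] := @tens_pure_bilinear K A B. Qed.

Let inner_bilinear a b :
  bilinear_map (mul_pure a b).
Proof.
rewrite /mul_pure; split=> [m k n n'|n k m m'] /=.
  by rewrite mulrDr -alg_scaleAr pureDr.
by rewrite mulrDr -alg_scaleAr pureDl.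
Qed.

Let outer_bilinear y : bilinear_map
  (fun a b => tens_lift (mul_pure a b) y).
Proof.
rewrite /mul_pure; split=> [m k n n'|n k m m'] /=; apply: tens_lift_comb => a b.
  by rewrite mulrDl -alg_scaleAl pureDr.
by rewrite mulrDl -alg_scaleAl pureDl.
Qed.

Lemma tens_mul_bilinear : bilinear_map tens_mul.
Proof.
split=> [x k y y'|y k x x']; last exact: tens_lift_linear.
by apply: tens_lift_comb => a b; apply: tens_lift_linear.
Qed.

Lemma tens_mul_pure a b a' b' :
  tens_mul (tens_pure a b) (tens_pure a' b') = tens_pure (a * a') (b * b').
Proof. by rewrite /tens_mul !tens_lift_pure. Qed.

Let mulDl x y z : tens_mul (x + y) z = tens_mul x z + tens_mul y z.
Proof.
by have [_ /(_ z 1 x y)] := tens_mul_bilinear; rewrite !scale1r.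
Qed.
Let mulDr x y z : tens_mul z (x + y) = tens_mul z x + tens_mul z y.
Proof.
by have [/(_ z 1 x y) + _] := tens_mul_bilinear; rewrite !scale1r.
Qed.

Lemma tens_mulA : associative tens_mul.
Proof.
move=> x y z; elim/tens_ind: x => [a b|x x' IH IH']; last first.
  by rewrite !mulDl IH IH'.
elim/tens_ind: y => [a' b'|y y' IH IH']; last first.
  by rewrite !mulDl !mulDr !mulDl IH IH'.
elim/tens_ind: z => [a'' b''|z z' IH IH']; last by rewrite !mulDr IH IH'.
by rewrite !tens_mul_pure !mulrA.
Qed.

Lemma tens_mul1 : left_id (tens_pure (1 : A) (1 : B)) tens_mul.
Proof.
by elim/tens_ind => [a b|x y ex ey]; rewrite ?mulDr ?ex ?ey //
  tens_mul_pure !mul1r.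
Qed.

Lemma tens_1mul : right_id (tens_pure (1 : A) (1 : B)) tens_mul.
Proof.
by elim/tens_ind => [a b|x y ex ey]; rewrite ?mulDl ?ex ?ey //
  tens_mul_pure !mulr1.
Qed.

Definition tens_alg : algebra K :=
  @Algebra K (tens A B) (tens_pure (1 : A) (1 : B)) tens_mul
    tens_mulA tens_mul1 tens_1mul tens_mul_bilinear.

Definition tpure (a : A) (b : B) : tens_alg := tens_pure a b.

Lemma tpure_bilinear : bilinear_map tpure.
Proof. exact: tens_pure_bilinear. Qed.

Lemma tpureM a b a' b' : tpure a b * tpure a' b' = tpure (a * a') (b * b').
Proof. exact: tens_mul_pure. Qed.

Lemma tpure1 : tpure 1 1 = 1. Proof. by []. Qed.

Lemma tens_alg_ind (Q : tens_alg -> Prop) :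
  (forall a b, Q (tpure a b)) -> (forall x y, Q x -> Q y -> Q (x + y)) ->
  forall x, Q x.
Proof. exact: tens_ind. Qed.

Lemma tens_alg_hom_eq C (f g : alg_hom tens_alg C) :
  (forall a b, f (tpure a b) = g (tpure a b)) -> f = g.
Proof.
move=> e; apply/alg_homP; elim/tens_alg_ind => // x y ex ey.
by rewrite !raddfD /= ex ey.
Qed.

Section Elim.
Variables (C : algebra K) (f : A -> B -> C).
Hypotheses (f_bilinear : bilinear_map f) (f1 : f 1 1 = 1)
  (fM : forall a b a' b', f (a * a') (b * b') = f a b * f a' b').

Let F (x : tens_alg) : C := tens_lift f x.

Lemma tens_elim_linear : linear F. Proof. exact: tens_lift_linear. Qed.

Lemma tens_elim_monoid : monoid_morphism F.
Proof.
have FD x y : F (x + y) = F x + F y.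
  by have := tens_elim_linear 1 x y; rewrite !scale1r.
have Fp a b : F (tpure a b) = f a b by apply: tens_lift_pure.
split=> [|x y]; first by rewrite -tpure1 Fp.
elim/tens_alg_ind: x => [a b|x x' IH IH']; last first.
  by rewrite mulrDl !FD mulrDl IH IH'.
elim/tens_alg_ind: y => [a' b'|y y' IH IH']; last first.
  by rewrite mulrDr !FD mulrDr IH IH'.
by rewrite tpureM !Fp.
Qed.

Definition tens_elim : alg_hom tens_alg C :=
  AlgHom tens_elim_linear tens_elim_monoid.

Lemma tens_elimE a b : tens_elim (tpure a b) = f a b.
Proof. exact: tens_lift_pure. Qed.

End Elim.
End Mul.
End TensAlg.

Arguments ground K : clear implicits.

Section TensMaps.
Variable K : fieldType.
Implicit Types A B C : algebra K.

Section Map.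
Variables (A A' B B' : algebra K) (f : alg_hom A A') (g : alg_hom B B').
Let F (a : A) (b : B) := tpure (f a) (g b).

Lemma tens_map_bilinear : bilinear_map F.
Proof.
have [hl hr] := @tpure_bilinear K A' B'.
by split=> [a k b b'|b k a a']; rewrite /F /= linearP ?hl ?hr.
Qed.
Lemma tens_map1 : F 1 1 = 1. Proof. by rewrite /F !rmorph1. Qed.
Lemma tens_mapM a b a' b' : F (a * a') (b * b') = F a b * F a' b'.
Proof. by rewrite /F !rmorphM tpureM. Qed.

Definition tens_map : alg_hom (tens_alg A B) (tens_alg A' B') :=
  tens_elim tens_map_bilinear tens_map1 tens_mapM.

Lemma tens_mapE a b : tens_map (tpure a b) = tpure (f a) (g b).
Proof. exact: tens_elimE. Qed.
End Map.

Section Flip.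
Variables A B : algebra K.
Let F (a : A) (b : B) := tpure b a.

Lemma tens_flip_bilinear : bilinear_map F.
Proof.
have [hl hr] := @tpure_bilinear K B A.
by split=> [a k b b'|b k a a']; rewrite /F /= ?hl ?hr.
Qed.
Lemma tens_flipM a b a' b' : F (a * a') (b * b') = F a b * F a' b'.
Proof. by rewrite /F tpureM. Qed.

Definition tens_flip : alg_hom (tens_alg A B) (tens_alg B A) :=
  tens_elim tens_flip_bilinear (tpure1 B A) tens_flipM.

Lemma tens_flipE a b : tens_flip (tpure a b) = tpure b a.
Proof. exact: tens_elimE. Qed.
End Flip.

Section Assoc.
Variables A B C : algebra K.

Let F0 (c : C) (a : A) (b : B) : tens_alg A (tens_alg B C) :=
  tpure a (tpure b c).
Let F (x : tens_alg A B) (c : C) : tens_alg A (tens_alg B C) :=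
  tens_lift (F0 c) x.

Let F0_bilinear c : bilinear_map (F0 c).
Proof.
have [hl hr] := @tpure_bilinear K A (tens_alg B C).
have [hl' hr'] := @tpure_bilinear K B C.
by split=> [a k b b'|b k a a']; rewrite /F0 /= ?hr' ?hl ?hr.
Qed.

Let FE a b c : F (tpure a b) c = tpure a (tpure b c).
Proof. exact: tens_lift_pure. Qed.

Lemma tens_assoc_bilinear : bilinear_map F.
Proof.
have [hl hr] := @tpure_bilinear K A (tens_alg B C).
have [hl' hr'] := @tpure_bilinear K B C.
split=> [x k c c'|c]; last exact: tens_lift_linear.
by apply: tens_lift_comb => a b; rewrite /F0 hl' hl.
Qed.

Lemma tens_assoc1 : F 1 1 = 1.
Proof. by rewrite -tpure1 FE. Qed.

Lemma tens_assocM x c x' c' : F (x * x') (c * c') = F x c * F x' c'.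
Proof.
have FD y y' d : F (y + y') d = F y d + F y' d.
  by have [_ /(_ d 1 y y')] := tens_assoc_bilinear; rewrite !scale1r.
elim/tens_alg_ind: x => [a b|x y IH IH']; last first.
  by rewrite mulrDl !FD mulrDl IH IH'.
elim/tens_alg_ind: x' => [a' b'|x y IH IH']; last first.
  by rewrite mulrDr !FD mulrDr IH IH'.
by rewrite tpureM !FE !tpureM.
Qed.

Definition tens_assoc :
    alg_hom (tens_alg (tens_alg A B) C) (tens_alg A (tens_alg B C)) :=
  tens_elim tens_assoc_bilinear tens_assoc1 tens_assocM.

Lemma tens_assocE a b c :
  tens_assoc (tpure (tpure a b) c) = tpure a (tpure b c).
Proof. by rewrite tens_elimE FE. Qed.
End Assoc.

Section RightUnit.
Variable A : algebra K.
Let F (a : A) (k : ground K) : A := (k : K) *: a.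

Lemma tens_runit_bilinear : bilinear_map F.
Proof.
split=> [a k l l'|l k a a'] /=; first by rewrite /F scalerDl -scalerA.
by rewrite /F scalerDr !scalerA mulrC.
Qed.
Lemma tens_runit1 : F 1 1 = 1. Proof. exact: scale1r. Qed.
Lemma tens_runitM a k a' k' : F (a * a') (k * k') = F a k * F a' k'.
Proof. by rewrite /F -alg_scaleAl -alg_scaleAr scalerA. Qed.

Definition tens_runit : alg_hom (tens_alg A (ground K)) A :=
  tens_elim tens_runit_bilinear tens_runit1 tens_runitM.

Lemma tens_runitE a (k : ground K) : tens_runit (tpure a k) = (k : K) *: a.
Proof. exact: tens_elimE. Qed.
End RightUnit.

Lemma tens_map_id A B :
  tens_map (alg_id A) (alg_id B) = alg_id (tens_alg A B).
Proof. by apply: tens_alg_hom_eq => a b; rewrite tens_mapE. Qed.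

Lemma tens_map_comp A A' A'' B B' B'' (f' : alg_hom A' A'') (f : alg_hom A A')
    (g' : alg_hom B' B'') (g : alg_hom B B') :
  tens_map (alg_comp f' f) (alg_comp g' g) =
  alg_comp (tens_map f' g') (tens_map f g).
Proof. by apply: tens_alg_hom_eq => a b; rewrite !(alg_compE, tens_mapE). Qed.

Lemma tens_flip_nat A A' B B' (f : alg_hom A A') (g : alg_hom B B') :
  alg_comp (tens_map g f) (tens_flip A B) =
  alg_comp (tens_flip A' B') (tens_map f g).
Proof.
by apply: tens_alg_hom_eq => a b; rewrite !(alg_compE, tens_flipE, tens_mapE).
Qed.

Lemma tens_alg_hom_eq3 A B C D
    (f g : alg_hom (tens_alg (tens_alg A B) C) D) :
  (forall a b c, f (tpure (tpure a b) c) = g (tpure (tpure a b) c)) -> f = g.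
Proof.
move=> e; apply: tens_alg_hom_eq => x c; elim/tens_alg_ind: x => // x y ex ey.
have [_ /(_ c 1 x y)] := @tpure_bilinear K (tens_alg A B) C.
by rewrite /= !scale1r => ->; rewrite !raddfD /= ex ey.
Qed.

Lemma tens_assoc_nat A A' B B' C C' (f : alg_hom A A') (g : alg_hom B B')
    (h : alg_hom C C') :
  alg_comp (tens_map f (tens_map g h)) (tens_assoc A B C) =
  alg_comp (tens_assoc A' B' C') (tens_map (tens_map f g) h).
Proof.
by apply: tens_alg_hom_eq3 => a b c; rewrite !(alg_compE, tens_assocE, tens_mapE).
Qed.

End TensMaps.

Set Primitive Projections.
Record category := Category {
  obj :> Type;
  mor : obj -> obj -> Type;
  idm : forall X, mor X X;
  cat_comp : forall X Y Z, mor Y Z -> mor X Y -> mor X Z;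
  comp_idl : forall X Y (f : mor X Y), cat_comp (idm Y) f = f;
  comp_idr : forall X Y (f : mor X Y), cat_comp f (idm X) = f;
  comp_assoc : forall X Y Z T (h : mor Z T) (g : mor Y Z) (f : mor X Y),
    cat_comp h (cat_comp g f) = cat_comp (cat_comp h g) f }.
Unset Primitive Projections.

Arguments mor {c} _ _.
Arguments idm {c} X.
Arguments cat_comp {c X Y Z} _ _.

Declare Scope cat_scope.
Delimit Scope cat_scope with cat.
Local Open Scope cat_scope.
Notation "g ∘ f" := (cat_comp g f) (at level 40, left associativity) : cat_scope.

Record functor (C D : category) := Functor {
  fobj :> C -> D;
  fmap : forall X Y : C, mor X Y -> mor (fobj X) (fobj Y);
  fmap_id : forall X, fmap (idm X) = idm (fobj X);
  fmap_comp : forall X Y Z (g : mor Y Z) (f : mor X Y),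
    fmap (g ∘ f) = fmap g ∘ fmap f }.

Arguments fmap {C D} _ {X Y} _.

Definition id_functor (C : category) : functor C C :=
  @Functor C C id (fun _ _ f => f) (fun _ => erefl) (fun _ _ _ _ _ => erefl).

Section FunctorComp.
Variables (C D E : category) (G : functor D E) (F : functor C D).
Lemma functor_comp_id X : fmap G (fmap F (idm X)) = idm (G (F X)).
Proof. by rewrite !fmap_id. Qed.
Lemma functor_comp_comp X Y Z (g : mor Y Z) (f : mor X Y) :
  fmap G (fmap F (g ∘ f)) = fmap G (fmap F g) ∘ fmap G (fmap F f).
Proof. by rewrite !fmap_comp. Qed.
Definition functor_comp : functor C E :=
  @Functor C E (fun X => G (F X)) (fun X Y f => fmap G (fmap F f))
    functor_comp_id functor_comp_comp.
End FunctorComp.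

Definition op_cat (C : category) : category :=
  @Category C (fun X Y => mor Y X) (fun X => idm X)
    (fun X Y Z g f => f ∘ g)
    (fun X Y f => comp_idr f) (fun X Y f => comp_idl f)
    (fun X Y Z T h g f => esym (comp_assoc f g h)).

Definition op_functor (C D : category) (F : functor C D) :
    functor (op_cat C) (op_cat D) :=
  @Functor (op_cat C) (op_cat D) F (fun X Y f => fmap F f)
    (fun X => fmap_id F X) (fun X Y Z g f => fmap_comp F f g).

Section ProdCat.
Variables C D : category.
Definition prod_hom (X Y : C * D) : Type := (mor X.1 Y.1 * mor X.2 Y.2)%type.
Definition prod_comp (X Y Z : C * D) (g : prod_hom Y Z) (f : prod_hom X Y) :
  prod_hom X Z := (g.1 ∘ f.1, g.2 ∘ f.2).
Lemma prod_idl X Y (f : prod_hom X Y) : prod_comp (idm Y.1, idm Y.2) f = f.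
Proof. by case: f => f g; rewrite /prod_comp /= !comp_idl. Qed.
Lemma prod_idr X Y (f : prod_hom X Y) : prod_comp f (idm X.1, idm X.2) = f.
Proof. by case: f => f g; rewrite /prod_comp /= !comp_idr. Qed.
Lemma prod_assoc X Y Z T (h : prod_hom Z T) (g : prod_hom Y Z)
  (f : prod_hom X Y) : prod_comp h (prod_comp g f) = prod_comp (prod_comp h g) f.
Proof. by rewrite /prod_comp /= !comp_assoc. Qed.
Definition prod_cat : category :=
  @Category (C * D)%type prod_hom (fun X => (idm X.1, idm X.2)) prod_comp
    prod_idl prod_idr prod_assoc.
End ProdCat.

Section ProdFunctor.
Variables (C D C' D' : category) (F : functor C C') (G : functor D D').
Let map (X Y : prod_cat C D) (f : mor X Y) :
    @mor (prod_cat C' D') (F X.1, G X.2) (F Y.1, G Y.2) :=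
  (fmap F f.1, fmap G f.2).
Lemma prod_functor_id X : map (idm X) = idm _.
Proof. by rewrite /map /= !fmap_id. Qed.
Lemma prod_functor_comp X Y Z (g : mor Y Z) (f : mor X Y) :
  map (g ∘ f) = map g ∘ map f.
Proof. by rewrite /map /= !fmap_comp. Qed.
Definition prod_functor : functor (prod_cat C D) (prod_cat C' D') :=
  @Functor (prod_cat C D) (prod_cat C' D') _ map
    prod_functor_id prod_functor_comp.
End ProdFunctor.

Definition bimap (C D E : category) (F : functor (prod_cat C D) E)
    (X X' : C) (Y Y' : D) (f : mor X X') (g : mor Y Y') :
    mor (F (X, Y)) (F (X', Y')) :=
  @fmap _ _ F (X, Y) (X', Y') (f, g).

Lemma bimap_id (C D E : category) (F : functor (prod_cat C D) E) X Y :
  bimap F (idm X) (idm Y) = idm (F (X, Y)).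
Proof. exact: (@fmap_id _ _ F (X, Y)). Qed.

Lemma bimap_comp (C D E : category) (F : functor (prod_cat C D) E)
    (X X' X'' : C) (Y Y' Y'' : D) (f' : mor X' X'') (f : mor X X')
    (g' : mor Y' Y'') (g : mor Y Y') :
  bimap F (f' ∘ f) (g' ∘ g) = bimap F f' g' ∘ bimap F f g.
Proof.
exact: (@fmap_comp _ _ F (X, Y) (X', Y') (X'', Y'') (f', g') (f, g)).
Qed.

Definition full_sub (C : category) (P : C -> Prop) : category :=
  @Category {X : C | P X} (fun X Y => mor (sval X) (sval Y))
    (fun X => idm (sval X)) (fun X Y Z g f => g ∘ f)
    (fun X Y f => comp_idl f) (fun X Y f => comp_idr f)
    (fun X Y Z T h g f => comp_assoc h g f).

Definition full_incl (C : category) (P : C -> Prop) :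
    functor (full_sub P) C :=
  @Functor (full_sub P) C (fun X => sval X) (fun X Y f => f)
    (fun _ => erefl) (fun _ _ _ _ _ => erefl).

Definition type_cat : category :=
  @Category Type (fun X Y => X -> Y) (fun X x => x)
    (fun X Y Z g f x => g (f x))
    (fun _ _ _ => erefl) (fun _ _ _ => erefl) (fun _ _ _ _ _ _ _ => erefl).

Section HomFunctor.
Variable C : category.
Let map (X Y : prod_cat (op_cat C) C) (f : mor X Y) :
  @mor type_cat (@mor C X.1 X.2) (@mor C Y.1 Y.2) := fun m => f.2 ∘ m ∘ f.1.
Lemma hom_functor_id X : map (idm X) = idm _.
Proof. by apply/funext => m; rewrite /map /= comp_idr comp_idl. Qed.
Lemma hom_functor_comp X Y Z (g : mor Y Z) (f : mor X Y) :
  map (g ∘ f) = map g ∘ map f.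
Proof. by apply/funext => m; rewrite /map /= !comp_assoc. Qed.
Definition hom_functor : functor (prod_cat (op_cat C) C) type_cat :=
  @Functor (prod_cat (op_cat C) C) type_cat _ map
    hom_functor_id hom_functor_comp.
End HomFunctor.

(* Covariant on [op_cat C]: it is the contravariant functor C(-, k) on [C]. *)
Section HomTo.
Variables (C : category) (k : C).
Let map (X Y : op_cat C) (f : mor X Y) :
  @mor type_cat (@mor C X k) (@mor C Y k) := fun m => cat_comp (c := C) m f.
Lemma hom_to_id X : map (idm X) = idm _.
Proof. by apply/funext => m; apply: comp_idr. Qed.
Lemma hom_to_comp X Y Z (g : mor Y Z) (f : mor X Y) :
  map (g ∘ f) = map g ∘ map f.
Proof. by apply/funext => m; apply: comp_assoc. Qed.
Definition hom_to : functor (op_cat C) type_cat :=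
  @Functor (op_cat C) type_cat _ map hom_to_id hom_to_comp.
End HomTo.

Definition natural_bijection (C : category) (F G : functor C type_cat) : Prop :=
  exists b : forall X : C, F X -> G X,
    (forall X, bijective (b X)) /\
    (forall (X Y : C) (f : mor X Y) (x : F X),
       b Y (fmap F f x) = fmap G f (b X x)).

(* A functor C × D^op -> E induces, on opposite categories and after exchanging
   the two factors, a functor (D^op)^op × C^op -> E^op. *)
Definition induced_op (C D E : category)
    (F : functor (prod_cat C (op_cat D)) E) :
    functor (prod_cat (op_cat (op_cat D)) (op_cat C)) (op_cat E) :=
  @Functor (prod_cat (op_cat (op_cat D)) (op_cat C)) (op_cat E)
    (fun X => F (X.2, X.1))
    (fun X Y f => @fmap _ _ F (Y.2, Y.1) (X.2, X.1) (f.2, f.1))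
    (fun X => @fmap_id _ _ F (X.2, X.1))
    (fun X Y Z g f =>
       @fmap_comp _ _ F (Z.2, Z.1) (Y.2, Y.1) (X.2, X.1) (f.2, f.1) (g.2, g.1)).

(* Directed preorders; antisymmetry is not required. *)
Record directed_set := DirectedSet {
  dir_car :> Type;
  dir_le : dir_car -> dir_car -> Prop;
  dir_refl : forall i, dir_le i i;
  dir_trans : forall i j k, dir_le i j -> dir_le j k -> dir_le i k;
  dir_inhabited : inhabited dir_car;
  dir_upper : forall i j, exists k, dir_le i k /\ dir_le j k }.

Arguments dir_refl {d} i.

Definition dir_unit : directed_set :=
  @DirectedSet unit (fun _ _ => True) (fun _ => I) (fun _ _ _ _ _ => I)
    (inhabits tt) (fun _ _ => ex_intro _ tt (conj I I)).

Section DirProd.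
Variables I J : directed_set.
Let le (x y : I * J) := dir_le x.1 y.1 /\ dir_le x.2 y.2.
Lemma dir_prod_refl x : le x x. Proof. by split; apply: dir_refl. Qed.
Lemma dir_prod_trans x y z : le x y -> le y z -> le x z.
Proof. by move=> [h1 h2] [h3 h4]; split; apply: dir_trans; eassumption. Qed.
Lemma dir_prod_inhabited : inhabited (I * J).
Proof. by have [i] := dir_inhabited I; have [j] := dir_inhabited J. Qed.
Lemma dir_prod_upper x y : exists z, le x z /\ le y z.
Proof.
have [i [hi hi']] := dir_upper x.1 y.1; have [j [hj hj']] := dir_upper x.2 y.2.
by exists (i, j).
Qed.
Definition dir_prod : directed_set :=
  @DirectedSet (I * J) le dir_prod_refl dir_prod_trans dir_prod_inhabited
    dir_prod_upper.
End DirProd.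

Record pro_obj (C : category) := ProObj {
  pro_idx : directed_set;
  pro_at :> pro_idx -> C;
  pro_tr : forall i j, dir_le i j -> mor (pro_at j) (pro_at i);
  pro_tr_id : forall i (h : dir_le i i), pro_tr h = idm (pro_at i);
  pro_tr_comp : forall i j k (hij : dir_le i j) (hjk : dir_le j k)
    (hik : dir_le i k), pro_tr hij ∘ pro_tr hjk = pro_tr hik }.

Arguments pro_tr {C} p {i j} _.

Section Quot.
Variables (T : Type) (R : T -> T -> Prop).
Hypotheses (Rrefl : forall x, R x x) (Rsym : forall x y, R x y -> R y x)
  (Rtrans : forall x y z, R x y -> R y z -> R x z).

Definition quot : Type := {P : T -> Prop | exists x, P = R x}.
Definition quot_class (x : T) : quot := exist _ (R x) (ex_intro _ x erefl).
Definition quot_repr (c : quot) : T := projT1 (cid (svalP c)).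

Lemma quot_reprK c : quot_class (quot_repr c) = c.
Proof.
rewrite /quot_repr; case: cid => x /= e; case: c e => P hP /= e.
by subst P; congr exist; apply: Prop_irrelevance.
Qed.
Lemma quot_eqP x y : quot_class x = quot_class y <-> R x y.
Proof.
split=> [[e]|xy]; first by rewrite e.
have e : R x = R y.
  apply/funext => z; apply/propext; split; apply: Rtrans => //; exact: Rsym.
rewrite /quot_class; move: (ex_intro _ _ _) (ex_intro _ _ _); rewrite e => p q.
by congr exist; apply: Prop_irrelevance.
Qed.
Lemma quot_ind (Q : quot -> Prop) : (forall x, Q (quot_class x)) -> forall c, Q c.
Proof. by move=> h c; rewrite -(quot_reprK c). Qed.
Lemma quot_repr_class x : R (quot_repr (quot_class x)) x.
Proof. by apply/quot_eqP; rewrite quot_reprK. Qed.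
End Quot.

Section Germ.
Variables (C : category).

(* [germ X D] is colim_i C(X_i, D); [germ_lvl] and [germ_map] choose a
   representative. *)
Section Def.
Variables (X : pro_obj C) (D : C).
Definition pregerm : Type := {i : pro_idx X & mor (X i) D}.
Definition Pregerm i (f : mor (X i) D) : pregerm := existT _ i f.
Definition germ_rel (u v : pregerm) : Prop :=
  exists k (hu : dir_le (projT1 u) k) (hv : dir_le (projT1 v) k),
    projT2 u ∘ pro_tr X hu = projT2 v ∘ pro_tr X hv.

Lemma germ_rel_refl u : germ_rel u u.
Proof. by exists (projT1 u), (dir_refl _), (dir_refl _). Qed.
Lemma germ_rel_sym u v : germ_rel u v -> germ_rel v u.
Proof. by move=> [k [hu [hv e]]]; exists k, hv, hu. Qed.
Lemma germ_rel_trans u v w : germ_rel u v -> germ_rel v w -> germ_rel u w.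
Proof.
move=> [k [hu [hv e]]] [k' [hv' [hw e']]].
have [m [h h']] := dir_upper k k'.
exists m, (dir_trans hu h), (dir_trans hw h').
rewrite -(pro_tr_comp hu h) -(pro_tr_comp hw h') !comp_assoc e -e'.
by rewrite -!comp_assoc (pro_tr_comp hv h (dir_trans hv h))
  (pro_tr_comp hv' h' (dir_trans hv h)).
Qed.

Definition germ : Type := quot germ_rel.
Definition germ_of i (f : mor (X i) D) : germ := quot_class germ_rel (Pregerm f).
Definition germ_lvl (c : germ) : pro_idx X := projT1 (quot_repr c).
Definition germ_map (c : germ) : mor (X (germ_lvl c)) D := projT2 (quot_repr c).

Lemma germ_eqP i (f : mor (X i) D) j (g : mor (X j) D) :
  germ_of f = germ_of g <->
  exists k (hi : dir_le i k) (hj : dir_le j k), f ∘ pro_tr X hi = g ∘ pro_tr X hj.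
Proof.
by rewrite quot_eqP //;
  [exact: germ_rel_refl|exact: germ_rel_sym|exact: germ_rel_trans].
Qed.

Lemma germK (c : germ) : germ_of (germ_map c) = c.
Proof.
rewrite -[RHS]quot_reprK /germ_of /Pregerm /germ_map /germ_lvl.
by case: (quot_repr c).
Qed.

Lemma germ_ind (Q : germ -> Prop) :
  (forall i (f : mor (X i) D), Q (germ_of f)) -> forall c, Q c.
Proof. by move=> h c; rewrite -(germK c). Qed.

Lemma germ_tr i j (h : dir_le i j) (f : mor (X i) D) :
  germ_of (f ∘ pro_tr X h) = germ_of f.
Proof.
apply/germ_eqP; exists j, (dir_refl j), h.
by rewrite pro_tr_id comp_idr.
Qed.
End Def.

Variable X : pro_obj C.

Definition germ_push D E (t : mor D E) (c : germ X D) : germ X E :=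
  germ_of (t ∘ germ_map c).

Lemma germ_pushE D E (t : mor D E) i (f : mor (X i) D) :
  germ_push t (germ_of f) = germ_of (t ∘ f).
Proof.
apply/germ_eqP; have /germ_eqP[k [h [h' e]]] := germK (germ_of f).
by exists k, h, h'; rewrite -!comp_assoc e.
Qed.

Lemma germ_push_id D (c : germ X D) : germ_push (idm D) c = c.
Proof. by elim/germ_ind: c => i f; rewrite germ_pushE comp_idl. Qed.

Lemma germ_push_comp D E E' (t' : mor E E') (t : mor D E) (c : germ X D) :
  germ_push t' (germ_push t c) = germ_push (t' ∘ t) c.
Proof. by elim/germ_ind: c => i f; rewrite !germ_pushE comp_assoc. Qed.
End Germ.

Section Pro.
Variable C : category.
Implicit Types X Y Z T : pro_obj C.

(* lim_j colim_i C(X_i, Y_j) *)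
Record pro_hom X Y := ProHom {
  pro_germ :> forall j, germ X (Y j);
  pro_germ_tr : forall i j (h : dir_le i j),
    germ_push (pro_tr Y h) (pro_germ j) = pro_germ i }.

Lemma pro_homP X Y (f g : pro_hom X Y) : (forall j, f j = g j) -> f = g.
Proof.
case: f g => [f hf] [g hg] /= fg.
have e : f = g by apply: functional_extensionality_dep.
by subst g; congr ProHom; apply: Prop_irrelevance.
Qed.

Section Comp.
Variables (X Y Z : pro_obj C) (g : pro_hom Y Z) (f : pro_hom X Y).
Definition pro_comp_germ D (c : germ Y D) : germ X D :=
  germ_push (germ_map c) (f (germ_lvl c)).

Lemma pro_comp_germE D j (t : mor (Y j) D) :
  pro_comp_germ (germ_of t) = germ_push t (f j).
Proof.
rewrite /pro_comp_germ; have /germ_eqP[k [h [h' e]]] := germK (germ_of t).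
by rewrite -(pro_germ_tr f h) -(pro_germ_tr f h') !germ_push_comp e.
Qed.

Lemma pro_comp_germ_push D E (t : mor D E) (c : germ Y D) :
  pro_comp_germ (germ_push t c) = germ_push t (pro_comp_germ c).
Proof.
elim/germ_ind: c => j s.
by rewrite germ_pushE !pro_comp_germE germ_push_comp.
Qed.

Lemma pro_comp_tr i j (h : dir_le i j) :
  germ_push (pro_tr Z h) (pro_comp_germ (g j)) = pro_comp_germ (g i).
Proof. by rewrite -pro_comp_germ_push pro_germ_tr. Qed.

Definition pro_comp : pro_hom X Z :=
  @ProHom X Z (fun k => pro_comp_germ (g k)) pro_comp_tr.
End Comp.

Section Id.
Variable X : pro_obj C.
Lemma pro_id_tr i j (h : dir_le i j) :
  germ_push (pro_tr X h) (germ_of (idm (X j))) = germ_of (idm (X i)).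
Proof.
by rewrite germ_pushE comp_idr -[pro_tr X h]comp_idl germ_tr.
Qed.
Definition pro_id : pro_hom X X := ProHom pro_id_tr.
End Id.

Lemma pro_comp_idl X Y (f : pro_hom X Y) : pro_comp (pro_id Y) f = f.
Proof. by apply: pro_homP => j /=; rewrite pro_comp_germE germ_push_id. Qed.

Lemma pro_comp_idr X Y (f : pro_hom X Y) : pro_comp f (pro_id X) = f.
Proof.
apply: pro_homP => j /=; elim/germ_ind: (f j) => i t.
by rewrite pro_comp_germE /= germ_pushE comp_idr.
Qed.

Lemma pro_comp_assoc X Y Z T (h : pro_hom Z T) (g : pro_hom Y Z)
  (f : pro_hom X Y) :
  pro_comp h (pro_comp g f) = pro_comp (pro_comp h g) f.
Proof.
apply: pro_homP => j /=; elim/germ_ind: (h j) => i t.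
by rewrite pro_comp_germE (pro_comp_germE g) pro_comp_germ_push.
Qed.

Definition pro_cat : category :=
  @Category (pro_obj C) pro_hom pro_id pro_comp
    pro_comp_idl pro_comp_idr pro_comp_assoc.

(* The pro-morphism whose component at [j] is the class of a single morphism
   X_(lvl j) -> Y_j. *)
Section Level.
Variables (X Y : pro_obj C) (lvl : pro_idx Y -> pro_idx X).
Hypothesis lvl_homo : forall i j, dir_le i j -> dir_le (lvl i) (lvl j).
Variable t : forall j, mor (X (lvl j)) (Y j).
Hypothesis t_nat : forall i j (h : dir_le i j),
  pro_tr Y h ∘ t j = t i ∘ pro_tr X (lvl_homo h).

Lemma pro_level_tr i j (h : dir_le i j) :
  germ_push (pro_tr Y h) (germ_of (t j)) = germ_of (t i).
Proof. by rewrite germ_pushE t_nat germ_tr. Qed.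
Definition pro_level : pro_hom X Y := ProHom pro_level_tr.
End Level.

(* An object of [C] as a pro-object over a one-element index set. *)
Definition pro_const (A : C) : pro_obj C :=
  @ProObj C dir_unit (fun _ => A) (fun _ _ _ => idm A) (fun _ _ => erefl)
    (fun _ _ _ _ _ _ => comp_idl (idm A)).

Section Const.
Variables (A B : C) (f : mor A B).
Let tr (i j : dir_unit) (h : dir_le i j) : idm B ∘ f = f ∘ idm A.
Proof. by rewrite comp_idl comp_idr. Qed.
Definition pro_const_map : pro_hom (pro_const A) (pro_const B) :=
  @pro_level (pro_const A) (pro_const B) id (fun _ _ h => h) (fun _ => f) tr.
End Const.

Lemma pro_const_id A : pro_const_map (idm A) = pro_id (pro_const A).
Proof. exact: pro_homP. Qed.
Lemma pro_const_comp A B D (g : mor B D) (f : mor A B) :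
  pro_const_map (g ∘ f) = pro_comp (pro_const_map g) (pro_const_map f).
Proof.
by apply: pro_homP => j /=; rewrite pro_comp_germE germ_pushE.
Qed.
Definition pro_unit : functor C pro_cat :=
  @Functor C pro_cat pro_const pro_const_map pro_const_id pro_const_comp.

End Pro.

Section ProFunctor.
Variables (C D : category) (F : functor C D).
Implicit Types X Y Z : pro_obj C.

Definition pro_fobj (X : pro_obj C) : pro_obj D.
refine (@ProObj D (pro_idx X) (fun i => F (X i))
  (fun i j h => fmap F (pro_tr X h)) _ _).
- by move=> i h; rewrite pro_tr_id fmap_id.
- by move=> i j k hij hjk hik; rewrite -fmap_comp (pro_tr_comp hij hjk hik).
Defined.

Definition germ_fmap X A (c : germ X A) : germ (pro_fobj X) (F A) :=
  @germ_of _ (pro_fobj X) (F A) (germ_lvl c) (fmap F (germ_map c)).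

Lemma germ_fmapE X A i (t : mor (X i) A) :
  germ_fmap (germ_of t) = @germ_of _ (pro_fobj X) (F A) i (fmap F t).
Proof.
apply/germ_eqP; have /germ_eqP[k [h [h' e]]] := germK (germ_of t).
by exists k, h, h'; rewrite /= -!fmap_comp e.
Qed.

Section Map.
Variables (X Y : pro_obj C) (f : pro_hom X Y).
Lemma pro_fmap_tr i j (h : dir_le i j) :
  germ_push (pro_tr (pro_fobj Y) h) (germ_fmap (f j)) = germ_fmap (f i).
Proof.
rewrite -(pro_germ_tr f h); elim/germ_ind: (f j) => k t.
by rewrite germ_pushE !germ_fmapE germ_pushE /= fmap_comp.
Qed.
Definition pro_fmap : pro_hom (pro_fobj X) (pro_fobj Y) :=
  @ProHom D (pro_fobj X) (pro_fobj Y) (fun j => germ_fmap (f j)) pro_fmap_tr.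
End Map.

Lemma pro_fmap_id X : pro_fmap (pro_id X) = pro_id (pro_fobj X).
Proof. by apply: pro_homP => j /=; rewrite germ_fmapE fmap_id. Qed.

Lemma pro_fmap_comp X Y Z (g : pro_hom Y Z) (f : pro_hom X Y) :
  pro_fmap (pro_comp g f) = pro_comp (pro_fmap g) (pro_fmap f).
Proof.
apply: pro_homP => k /=; elim/germ_ind: (g k) => j t.
rewrite pro_comp_germE germ_fmapE pro_comp_germE /=.
by elim/germ_ind: (f j) => i s; rewrite germ_pushE !germ_fmapE germ_pushE fmap_comp.
Qed.

Definition pro_functor : functor (pro_cat C) (pro_cat D) :=
  @Functor (pro_cat C) (pro_cat D) pro_fobj pro_fmap pro_fmap_id pro_fmap_comp.
End ProFunctor.

(* Transparent versions of [proj1] and [proj2]. *)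
Definition and_l (P Q : Prop) (h : P /\ Q) : P := let: conj p _ := h in p.
Definition and_r (P Q : Prop) (h : P /\ Q) : Q := let: conj _ q := h in q.

Section ProBifunctor.
Variables (C D E : category) (F : functor (prod_cat C D) E).
Implicit Types (X : pro_obj C) (Y : pro_obj D).

Definition pro_bobj (X : pro_obj C) (Y : pro_obj D) : pro_obj E.
refine (@ProObj E (dir_prod (pro_idx X) (pro_idx Y))
  (fun i => F (X i.1, Y i.2))
  (fun i j h => bimap F (pro_tr X (and_l h)) (pro_tr Y (and_r h))) _ _).
- by move=> i h; rewrite !pro_tr_id bimap_id.
- move=> i j k hij hjk hik; rewrite -bimap_comp.
  by rewrite (pro_tr_comp _ _ (and_l hik)) (pro_tr_comp _ _ (and_r hik)).
Defined.

Definition germ_bimap X Y A B (c : germ X A) (d : germ Y B) :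
    germ (pro_bobj X Y) (F (A, B)) :=
  @germ_of _ (pro_bobj X Y) _ (germ_lvl c, germ_lvl d)
    (bimap F (germ_map c) (germ_map d)).

Lemma germ_bimapE X Y A B i (s : mor (X i) A) j (t : mor (Y j) B) :
  germ_bimap (germ_of s) (germ_of t) =
  @germ_of _ (pro_bobj X Y) _ (i, j) (bimap F s t).
Proof.
apply/germ_eqP; have /germ_eqP[k [h [h' e]]] := germK (germ_of s).
have /germ_eqP[l [m [m' e']]] := germK (germ_of t).
by exists (k, l), (conj h m), (conj h' m'); rewrite /= -!bimap_comp e e'.
Qed.

Section Map.
Variables (X X' : pro_obj C) (Y Y' : pro_obj D).
Variables (f : pro_hom X X') (g : pro_hom Y Y').
Lemma pro_bimap_tr (i j : pro_idx (pro_bobj X' Y')) (h : dir_le i j) :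
  germ_push (pro_tr (pro_bobj X' Y') h) (germ_bimap (f j.1) (g j.2)) =
  germ_bimap (f i.1) (g i.2).
Proof.
rewrite -(pro_germ_tr f (and_l h)) -(pro_germ_tr g (and_r h)).
elim/germ_ind: (f j.1) => k s; elim/germ_ind: (g j.2) => l t.
by rewrite germ_bimapE !germ_pushE germ_bimapE /= bimap_comp.
Qed.
Definition pro_bimap : pro_hom (pro_bobj X Y) (pro_bobj X' Y') :=
  @ProHom E (pro_bobj X Y) (pro_bobj X' Y')
    (fun j => germ_bimap (f j.1) (g j.2)) pro_bimap_tr.
End Map.

Lemma pro_bimap_id X Y :
  pro_bimap (pro_id X) (pro_id Y) = pro_id (pro_bobj X Y).
Proof. by apply: pro_homP => -[i j] /=; rewrite germ_bimapE bimap_id. Qed.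

Lemma pro_bimap_comp X X' X'' Y Y' Y'' (f' : pro_hom X' X'') (f : pro_hom X X')
    (g' : pro_hom Y' Y'') (g : pro_hom Y Y') :
  pro_bimap (pro_comp f' f) (pro_comp g' g) =
  pro_comp (pro_bimap f' g') (pro_bimap f g).
Proof.
apply: pro_homP => -[k l] /=.
elim/germ_ind: (f' k) => i s; elim/germ_ind: (g' l) => j t.
rewrite (germ_bimapE s t) !pro_comp_germE /=.
elim/germ_ind: (f i) => m u; elim/germ_ind: (g j) => n v.
by rewrite (germ_bimapE u v) !germ_pushE germ_bimapE bimap_comp.
Qed.

Definition pro_bifunctor :
    functor (prod_cat (pro_cat C) (pro_cat D)) (pro_cat E) :=
  @Functor (prod_cat (pro_cat C) (pro_cat D)) (pro_cat E)
    (fun XY => pro_bobj XY.1 XY.2) (fun _ _ fg => pro_bimap fg.1 fg.2)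
    (fun XY => pro_bimap_id XY.1 XY.2)
    (fun _ _ _ fg' fg => pro_bimap_comp fg'.1 fg.1 fg'.2 fg.2).

(* Both pro-objects are F(A, B) over a one-element index set, [unit] for the
   source and [unit * unit] for the target. *)
Section Const.
Variables (A : C) (B : D).
Let lvl (j : pro_idx (pro_bobj (pro_const A) (pro_const B))) :
  pro_idx (pro_const (F (A, B))) := tt.
Let tr (i j : dir_prod dir_unit dir_unit) (h : dir_le i j) :
  bimap F (idm A) (idm B) ∘ idm (F (A, B)) = idm (F (A, B)) ∘ idm _.
Proof. by rewrite bimap_id. Qed.
Definition pro_bifunctor_const :
    @mor (pro_cat E) (pro_const (F (A, B)))
      (pro_bifunctor (pro_const A, pro_const B)) :=
  @pro_level E (pro_const (F (A, B))) (pro_bobj (pro_const A) (pro_const B))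
    lvl (fun _ _ _ => I) (fun _ => idm _) tr.
End Const.
End ProBifunctor.

Section AlgCat.
Variable K : fieldType.

Lemma alg_comp_idl (A B : algebra K) (f : alg_hom A B) :
  alg_comp (alg_id B) f = f.
Proof. exact: alg_homP. Qed.
Lemma alg_comp_idr (A B : algebra K) (f : alg_hom A B) :
  alg_comp f (alg_id A) = f.
Proof. exact: alg_homP. Qed.
Lemma alg_comp_assoc (A B C D : algebra K) (h : alg_hom C D) (g : alg_hom B C)
  (f : alg_hom A B) : alg_comp h (alg_comp g f) = alg_comp (alg_comp h g) f.
Proof. exact: alg_homP. Qed.

Definition alg_cat : category :=
  @Category (algebra K) (@alg_hom K) (@alg_id K) (@alg_comp K)
    alg_comp_idl alg_comp_idr alg_comp_assoc.

Let tmap (X Y : prod_cat alg_cat alg_cat) (f : mor X Y) :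
    @mor alg_cat (tens_alg X.1 X.2) (tens_alg Y.1 Y.2) := tens_map f.1 f.2.

Definition tens_functor : functor (prod_cat alg_cat alg_cat) alg_cat :=
  @Functor (prod_cat alg_cat alg_cat) alg_cat
    (fun X => tens_alg X.1 X.2) tmap
    (fun X => tens_map_id X.1 X.2)
    (fun X Y Z g f => tens_map_comp g.1 f.1 g.2 f.2).

Definition fin_dim (A : algebra K) : Prop :=
  exists s : seq A, forall a : A,
    exists c : 'I_(size s) -> K, a = \sum_i c i *: s`_i.

Definition fin_gen (A : algebra K) : Prop :=
  exists s : seq A, forall P : A -> Prop,
    P 1 -> (forall (k : K) x y, P x -> P y -> P (k *: x + y)) ->
    (forall x y, P x -> P y -> P (x * y)) ->
    (forall x, x \in s -> P x) -> forall a, P a.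

Definition alg_fg_cat : category := @full_sub alg_cat fin_gen.

Definition pro_fg_incl : functor (pro_cat alg_fg_cat) (pro_cat alg_cat) :=
  pro_functor (@full_incl alg_cat fin_gen).

(* (X ⊗ Y)_(i, j) = X_i ⊗ Y_j *)
Definition pro_tens_functor :
    functor (prod_cat (pro_cat alg_cat) (pro_cat alg_cat)) (pro_cat alg_cat) :=
  pro_bifunctor tens_functor.

Section Coherence.
Variables X Y Z : pro_obj alg_cat.

Let flip_lvl (j : dir_prod (pro_idx Y) (pro_idx X)) :
  dir_prod (pro_idx X) (pro_idx Y) := (j.2, j.1).
Let flip_homo i j (h : dir_le i j) : dir_le (flip_lvl i) (flip_lvl j) :=
  conj (and_r h) (and_l h).
Let flip_at (j : dir_prod (pro_idx Y) (pro_idx X)) :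
    @mor alg_cat (tens_functor (X j.2, Y j.1)) (tens_functor (Y j.1, X j.2)) :=
  tens_flip (X j.2) (Y j.1).

Lemma pro_flip_nat i j (h : dir_le i j) :
  pro_tr (pro_bobj tens_functor Y X) h ∘ flip_at j =
  flip_at i ∘ pro_tr (pro_bobj tens_functor X Y) (flip_homo h).
Proof. exact: tens_flip_nat. Qed.

Definition pro_flip : @mor (pro_cat alg_cat)
    (pro_tens_functor (X, Y)) (pro_tens_functor (Y, X)) :=
  @pro_level alg_cat (pro_bobj tens_functor X Y) (pro_bobj tens_functor Y X)
    flip_lvl flip_homo flip_at pro_flip_nat.

Let src := pro_bobj tens_functor (pro_bobj tens_functor X Y) Z.
Let tgt := pro_bobj tens_functor X (pro_bobj tens_functor Y Z).
Let assoc_lvl (j : pro_idx tgt) : pro_idx src := ((j.1, j.2.1), j.2.2).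
Let assoc_homo (i j : pro_idx tgt) (h : dir_le i j) :
    dir_le (assoc_lvl i) (assoc_lvl j) :=
  conj (conj (and_l h) (and_l (and_r h))) (and_r (and_r h)).
Let assoc_at (j : pro_idx tgt) : @mor alg_cat (src (assoc_lvl j)) (tgt j) :=
  tens_assoc (X j.1) (Y j.2.1) (Z j.2.2).

Lemma pro_assoc_nat (i j : pro_idx tgt) (h : dir_le i j) :
  pro_tr tgt h ∘ assoc_at j = assoc_at i ∘ pro_tr src (assoc_homo h).
Proof. exact: tens_assoc_nat. Qed.

Definition pro_assoc : @mor (pro_cat alg_cat)
    (pro_tens_functor (pro_tens_functor (X, Y), Z))
    (pro_tens_functor (X, pro_tens_functor (Y, Z))) :=
  @pro_level alg_cat src tgt assoc_lvl assoc_homo assoc_at pro_assoc_nat.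
End Coherence.
End AlgCat.

(* The flip turns the left counit law, in K ⊗ H, into an equation in H ⊗ K. The
   two antipode laws are m (S ⊗ id) Δ = η ε = m (id ⊗ S) Δ, with the linear maps
   m (S ⊗ id) and m (id ⊗ S) given by the corresponding bilinear maps. *)
Record hopf_algebra (K : fieldType) := HopfAlgebra {
  hopf_alg :> algebra K;
  comul : alg_hom hopf_alg (tens_alg hopf_alg hopf_alg);
  counit : alg_hom hopf_alg (ground K);
  antipode : hopf_alg -> hopf_alg;
  comul_assoc : forall x,
    tens_assoc _ _ _ (tens_map comul (alg_id hopf_alg) (comul x)) =
    tens_map (alg_id hopf_alg) comul (comul x);
  comul_counitr : forall x,
    tens_runit hopf_alg (tens_map (alg_id hopf_alg) counit (comul x)) = x;
  comul_counitl : forall x,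
    tens_runit hopf_alg
      (tens_flip _ _ (tens_map counit (alg_id hopf_alg) (comul x))) = x;
  antipode_linear : linear antipode;
  antipode_l : forall x,
    tens_lift (fun a b : hopf_alg => antipode a * b) (comul x) =
    (counit x : K) *: (1 : hopf_alg);
  antipode_r : forall x,
    tens_lift (fun a b : hopf_alg => a * antipode b) (comul x) =
    (counit x : K) *: (1 : hopf_alg) }.

Section Comodules.
Variables (K : fieldType) (H : hopf_algebra K).

(* Comodules are comodule algebras: the coaction is an algebra morphism. *)
Record comodule := Comodule {
  com_alg :> algebra K;
  coact : alg_hom com_alg (tens_alg com_alg H);
  coact_assoc : forall v,
    tens_assoc _ _ _ (tens_map coact (alg_id H) (coact v)) =
    tens_map (alg_id com_alg) (comul H) (coact v);
  coact_counit : forall v,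
    tens_runit com_alg (tens_map (alg_id com_alg) (counit H) (coact v)) = v }.

Record com_hom (V W : comodule) := ComHom {
  com_fun :> alg_hom V W;
  com_hom_coact : forall v,
    coact W (com_fun v) = tens_map com_fun (alg_id H) (coact V v) }.

Lemma com_homP V W (f g : com_hom V W) : com_fun f = com_fun g -> f = g.
Proof.
case: f g => [f hf] [g hg] /= e; subst g; congr ComHom.
exact: Prop_irrelevance.
Qed.

Lemma com_id_coact (V : comodule) v :
  coact V (alg_id V v) = tens_map (alg_id V) (alg_id H) (coact V v).
Proof. by rewrite tens_map_id. Qed.
Definition com_id (V : comodule) : com_hom V V := ComHom (@com_id_coact V).

Lemma com_comp_coact (U V W : comodule) (g : com_hom V W) (f : com_hom U V) u :
  coact W (alg_comp g f u) = tens_map (alg_comp g f) (alg_id H) (coact U u).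
Proof.
rewrite -(alg_comp_idl (alg_id H)) tens_map_comp !alg_compE !com_hom_coact.
by [].
Qed.
Definition com_comp U V W (g : com_hom V W) (f : com_hom U V) : com_hom U W :=
  ComHom (com_comp_coact g f).

Lemma com_comp_idl U V (f : com_hom U V) : com_comp (com_id V) f = f.
Proof. exact/com_homP/alg_comp_idl. Qed.
Lemma com_comp_idr U V (f : com_hom U V) : com_comp f (com_id U) = f.
Proof. exact/com_homP/alg_comp_idr. Qed.
Lemma com_comp_assoc U V W T (h : com_hom W T) (g : com_hom V W)
  (f : com_hom U V) : com_comp h (com_comp g f) = com_comp (com_comp h g) f.
Proof. exact/com_homP/alg_comp_assoc. Qed.

Definition com_cat : category :=
  @Category comodule com_hom com_id com_comp
    com_comp_idl com_comp_idr com_comp_assoc.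

Definition com_fin_dim (V : com_cat) : Prop := fin_dim (com_alg V).
Definition com_fin_gen (V : com_cat) : Prop := fin_gen (com_alg V).

Definition com_fd_cat : category := full_sub com_fin_dim.
Definition com_fg_cat : category := full_sub com_fin_gen.

End Comodules.

Section Schemes.
Variables (K : fieldType) (H : hopf_algebra K).

(* The duality functor is a mere renaming, so the scheme dual to an algebra A is
   A itself, seen as an object of the opposite category. *)
Definition scheme_cat : category := op_cat (alg_cat K).
Definition ind_scheme_cat : category := op_cat (pro_cat (alg_fg_cat K)).

(* The points of the dual of a (pro-)algebra A are the (pro-)algebra morphisms
   from A to the field, which in the second case is seen as a pro-algebra. *)
Definition points : functor scheme_cat type_cat :=
  @hom_to (alg_cat K) (ground K).
Definition ind_points : functor ind_scheme_cat type_cat :=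
  functor_comp
    (@hom_to (pro_cat (alg_cat K)) (pro_unit (alg_cat K) (ground K)))
    (op_functor (pro_fg_incl K)).

Definition gscheme_cat : category := op_cat (com_cat H).
(* Beware of the two suffixes: G/S_fnt is dual to the finite dimensional
   comodules and G/S_fd to the finitely generated ones. *)
Definition gscheme_fnt_cat : category := op_cat (com_fd_cat H).
Definition gscheme_fd_cat : category := op_cat (com_fg_cat H).

Definition gscheme_fnt_incl : functor gscheme_fnt_cat gscheme_cat :=
  op_functor (full_incl (@com_fin_dim K H)).
Definition gscheme_fd_incl : functor gscheme_fd_cat gscheme_cat :=
  op_functor (full_incl (@com_fin_gen K H)).

Definition gmaps_fnt :
    functor (prod_cat (op_cat gscheme_fnt_cat) gscheme_cat) type_cat :=
  functor_comp (hom_functor gscheme_cat)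
    (prod_functor (op_functor gscheme_fnt_incl) (id_functor gscheme_cat)).
Definition gmaps_fd :
    functor (prod_cat (op_cat gscheme_cat) gscheme_fd_cat) type_cat :=
  functor_comp (hom_functor gscheme_cat)
    (prod_functor (id_functor (op_cat gscheme_cat)) gscheme_fd_incl).

End Schemes.

Section Families.
Variables (K : fieldType) (H : hopf_algebra K).

Local Notation Alg := (alg_cat K).
Local Notation tens := (tens_functor K).
Local Notation ptens := (pro_tens_functor K).
Local Notation cst A := (pro_unit Alg A).

(* (id_V ⊗ F) (ρ ⊗ id_U) φ = (φ ⊗ id_H) ϱ, with the associativity isomorphisms
   made explicit: both sides are morphisms W -> V ⊗ (U ⊗ H). *)
Definition is_family (W V : comodule H) (U : algebra K)
    (phi : @mor Alg W (tens (V : Alg, U : Alg))) : Prop :=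
  bimap tens (idm (V : Alg)) (tens_flip H U) ∘ tens_assoc V H U
    ∘ bimap tens (coact V) (idm (U : Alg)) ∘ phi =
  (tens_assoc V U H : @mor Alg _ _)
    ∘ bimap tens phi (idm (H : Alg)) ∘ coact W.

Definition pro_coact (V : comodule H) :
    @mor (pro_cat Alg) (cst V) (ptens (cst V, cst H)) :=
  pro_bifunctor_const tens V H ∘ fmap (pro_unit Alg) (coact V).

Definition is_pro_family (W V : comodule H) (U : pro_cat Alg)
    (phi : @mor (pro_cat Alg) (cst W) (ptens (cst V, U))) : Prop :=
  bimap ptens (idm (cst V)) (pro_flip (cst H) U) ∘ pro_assoc (cst V) (cst H) U
    ∘ bimap ptens (pro_coact V) (idm U) ∘ phi =
  pro_assoc (cst V) U (cst H) ∘ bimap ptens phi (idm (cst H)) ∘ pro_coact W.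

Section Finite.
Variable A : functor (prod_cat (com_cat H) (op_cat (com_fd_cat H))) Alg.
Variable h : forall (W : com_cat H) (V : com_fd_cat H),
  @mor Alg (com_alg W) (tens (com_alg (sval V) : Alg, A (W, V))).

Definition universal_families : Prop :=
  forall (W : com_cat H) (V : com_fd_cat H),
    is_family (h W V) /\
    forall (U : algebra K)
        (phi : @mor Alg (com_alg W) (tens (com_alg (sval V) : Alg, U : Alg))),
      is_family phi ->
      exists! phi' : mor (A (W, V)) (U : Alg),
        phi = bimap tens (idm (com_alg (sval V) : Alg)) phi' ∘ h W V.

(* (g, f) is a morphism (W, V) -> (W', V') because A is contravariant in V. *)
Definition natural_families : Prop :=
  forall (W W' : com_cat H) (V V' : com_fd_cat H) (g : mor W W') (f : mor V' V),
    bimap tens (idm (com_alg (sval V) : Alg))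
        (@bimap _ (op_cat _) _ A W W' V V' g f) ∘ h W V =
    bimap tens (com_fun f) (idm (A (W', V'))) ∘ h W' V' ∘ com_fun g.
End Finite.

Section ProFinite.
Variable A : functor (prod_cat (com_fg_cat H) (op_cat (com_cat H)))
  (pro_cat (alg_fg_cat K)).
Variable h : forall (W : com_fg_cat H) (V : com_cat H),
  @mor (pro_cat Alg) (cst (com_alg (sval W)))
    (ptens (cst (com_alg V), pro_fg_incl K (A (W, V)))).

Definition universal_pro_families : Prop :=
  forall (W : com_fg_cat H) (V : com_cat H),
    is_pro_family (h W V) /\
    forall (U : pro_cat Alg)
        (phi : @mor (pro_cat Alg) (cst (com_alg (sval W)))
                 (ptens (cst (com_alg V), U))),
      is_pro_family phi ->
      exists! phi' : mor (pro_fg_incl K (A (W, V))) U,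
        phi = bimap ptens (idm (cst (com_alg V))) phi' ∘ h W V.

Definition natural_pro_families : Prop :=
  forall (W W' : com_fg_cat H) (V V' : com_cat H) (g : mor W W') (f : mor V' V),
    bimap ptens (idm (cst (com_alg V)))
        (fmap (pro_fg_incl K) (@bimap _ (op_cat _) _ A W W' V V' g f)) ∘ h W V =
    bimap ptens (fmap (pro_unit Alg) (com_fun f))
        (idm (pro_fg_incl K (A (W', V'))))
      ∘ h W' V' ∘ fmap (pro_unit Alg) (com_fun g).
End ProFinite.

End Families.

(* Main.v *)
From HB Require Import structures.
Require Import Defs.
From mathcomp Require Import all_boot all_order all_algebra.
From mathcomp Require Import boolp classical_sets.

(** A family [W -> V ⊗ U] is determined by its slices, the elements
    [(mu ⊗ id) (phi w)] of [U] for [mu] a linear functional on [V] and [w] in a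
    set of generators of [W]. So the algebra carrying the universal family has
    to be generated by symbols for the slices, subject to whatever relations
    hold between the slices of all families. [pres_alg] takes this literally: it consists of
    the expressions in the symbols, modulo the equalities that every family
    validates. Its morphisms to the targets of families are then jointly
    injective, and they remain so after tensoring with [V] and with [H], because
    linear functionals separate the points of a vector space ([functional_sep],
    [slice_sep]). Every identity about the universal family, such as
    multiplicativity or equivariance, can therefore be checked on actual
    families, where it holds by hypothesis.

    The one thing that this does not provide is the value of the universal family
    at a point of [W], that is, a tensor with prescribed slices: finitely many
    vectors of [V] have to suffice to write it down. Hence one fixes generators
    [g i] of [W] and a finite sequence [s] in [V] and considers only the families
    that send each [g i] into [span s ⊗ U]; on the generators the universal one
    is a finite sum over a frame of [s] ([frame_exists]), and multiplicativity
    extends it to [W]. This is [rep_universal].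

    When [V] is finite dimensional, a spanning sequence [s] imposes no condition
    and the resulting algebra represents all families. When [W] is finitely
    generated, every family is supported on some finite [s], the algebras for the
    various [s] are finitely generated ([rep_fin_gen]), and together they form a
    pro-algebra indexed by the finite sequences of [V], which represents all
    pro-families ([rep_system_universal]); a pro-family is treated there
    through its components, each of which is a family ([is_pro_familyP]).

    In both cases functoriality, naturality and the bijection follow formally
    from the universal property ([universal_functor], [universal_bijection]):
    the points are the families over the ground field, and these are the
    comodule morphisms ([family_inl]). *)

Set Implicit Arguments.
Unset Strict Implicit.
Unset Printing Implicit Defensive.

Import GRing.Theory.
Local Open Scope ring_scope.
Local Open Scope cat_scope.

(** * Linear functionals on a vector space *)

Record functional (K : fieldType) (V : lmodType K) := Functional {
  functional_fun :> V -> K^o;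
  functional_linear : linear functional_fun }.

HB.instance Definition _ (K : fieldType) (V : lmodType K)
    (mu : functional V) :=
  GRing.isLinear.Build K V K^o *:%R (functional_fun mu) (functional_linear mu).

Section Functionals.
Variables (K : fieldType) (V : lmodType K).
Implicit Types (mu : functional V) (fr : seq (functional V * V)).

(** By Zorn's lemma there is a subspace maximal among those avoiding [w]; it is
    a complement of the line through [w], and [mu] is the projection along
    it. *)
Lemma functional_sep (w : V) : w <> 0 -> exists mu, mu w = 1.
Proof.
move=> w0; pose P (A : set V) :=
  (forall (k : K) x y, A x -> A y -> A (k *: x + y)) /\ ~ A w.
have [F FP Ftot|A [[Alin Aw] Amax]] := @Zorn_bigcup _ P.
  split=> [k x y [X FX Xx] [Y FY Yy]|[X FX Xw]]; last by case: (FP _ FX).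
  have [XY|YX] := Ftot X Y FX FY.
    by exists Y => //; apply: (FP _ FY).1 => //; apply: XY.
  by exists X => //; apply: (FP _ FX).1 => //; apply: YX.
have A0 : A 0.
  have [[x Ax]|nA] := pselect (exists x, A x).
    by have := Alin (-1) x x Ax Ax; rewrite scaleN1r addNr.
  exfalso; apply: (Amax [set 0]%classic).
    split=> [x Ax|]; first by case: nA; exists x.
    by move=> /(_ 0 erefl) A0; case: nA; exists 0.
  split=> [k x y -> ->|/= e]; last exact: w0.
  by rewrite scaler0 addr0.
have AZ k x : A x -> A (k *: x).
  by move=> Ax; have := Alin k x 0 Ax A0; rewrite addr0.
have coord v : exists c : K, A (v - c *: w).
  have [Av|nAv] := pselect (A v).
    by exists 0; rewrite scale0r subr0.
  have [c [a [Aa e]]] : exists c a, A a /\ w = c *: v + a.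
    apply/not_existsP => nw.
    apply: (Amax [set x | exists c a, A a /\ x = c *: v + a]%classic).
      split=> [x Ax|/(_ v) sub]; first by exists 0, x; rewrite scale0r add0r.
      by apply/nAv/sub; exists 1, 0; rewrite scale1r addr0.
    split=> [k x y [c [a [Aa ->]]] [d [b [Ab ->]]]|[c ew]]; last exact: (nw c).
    exists (k * c + d), (k *: a + b); split; first exact: Alin.
    by rewrite scalerDr scalerA addrACA -scalerDl.
  have c0 : c != 0.
    by apply/eqP => c0; apply: Aw; rewrite e c0 scale0r add0r.
  exists c^-1; rewrite e scalerDr scalerA mulVf // scale1r opprD addrA subrr.
  by rewrite sub0r -scalerN; apply/AZ; rewrite -scaleN1r; apply/AZ.
pose c v : K^o := sval (cid (coord v)).
have cP v : A (v - c v *: w) by rewrite /c; case: cid.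
have c_uniq v d : A (v - d *: w) -> c v = d.
  move=> Ad; apply/eqP; rewrite -subr_eq0; apply/negPn/negP => n0; apply: Aw.
  have := Alin (-1) _ _ (cP v) Ad.
  rewrite scaleN1r opprB addrA subrK -scalerBl => /(AZ (c v - d)^-1).
  by rewrite scalerA mulVf // scale1r.
have clin : linear c.
  move=> k x y; apply: c_uniq.
  have -> : k *: x + y - (k *: c x + c y) *: w =
      k *: (x - c x *: w) + (y - c y *: w).
    by rewrite scalerBr scalerDl opprD addrACA scalerA.
  exact: Alin.
exists (Functional clin); apply: c_uniq.
by rewrite scale1r subrr.
Qed.

(** A frame plays the role of a basis with its dual basis. Storing functionals
    on the whole of [V] next to the vectors avoids any discussion of linear
    independence. *)
Definition frame_op fr (v : V) : V := \sum_(p <- fr) p.1 v *: p.2.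

Lemma frame_op_linear fr : linear (frame_op fr).
Proof.
move=> k x y; rewrite /frame_op scaler_sumr -big_split.
by apply: eq_bigr => p _ /=; rewrite linearP scalerDl scalerA.
Qed.

Definition frame_rest fr mu (v : V) : K^o := mu (v - frame_op fr v).

Lemma frame_rest_linear fr mu : linear (frame_rest fr mu).
Proof.
move=> k x y; rewrite /frame_rest frame_op_linear -linearP; congr (mu _).
by rewrite scalerBr opprD addrACA.
Qed.

Definition frame_restf fr mu := Functional (frame_rest_linear fr mu).

Lemma frame_restE fr mu v :
  frame_rest fr mu v = mu v - \sum_(p <- fr) p.1 v * mu p.2.
Proof.
rewrite /frame_rest linearB /frame_op linear_sum; congr (_ - _).
by apply: eq_bigr => p _; rewrite linearZ.
Qed.

Definition frames (s : seq V) fr : Prop :=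
  forall v, v \in s -> frame_op fr v = v.

(** Vectors are treated one at a time: if the current frame does not reproduce
    [v], the error [v - frame_op fr v] is added to it, together with a
    functional that vanishes on the vectors treated before. *)
Lemma frame_exists (s : seq V) : exists fr, frames s fr.
Proof.
elim: s => [|v s [fr sfr]]; first by exists [::].
have [e|ne] := eqVneq (frame_op fr v) v.
  by exists fr => u; rewrite inE => /predU1P[->|/sfr].
have [|mu mu1] := @functional_sep (v - frame_op fr v).
  by move/eqP; rewrite subr_eq0 eq_sym; apply/negP.
exists ((frame_restf fr mu, v - frame_op fr v) :: fr) => u.
rewrite inE /frame_op big_cons -/(frame_op fr u) /= /frame_rest.
move=> /predU1P[->|us].
  by rewrite [X in X *: _]mu1 scale1r subrK.
by rewrite (sfr u us) subrr linear0 scale0r add0r.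
Qed.
End Functionals.

(** * Slices of a tensor *)

Section Slices.
Variables (K : fieldType) (V U : lmodType K).
Implicit Types (mu : functional V) (x y : tens V U).

Definition slice (mu : V -> K^o) x : U :=
  tens_lift (fun v u => (mu v : K) *: u) x.

Lemma slice_bilinear mu : bilinear_map (fun v (u : U) => (mu v : K) *: u).
Proof.
split=> [v k u u'|u k v v'] /=; first by rewrite scalerDr !scalerA mulrC.
by rewrite linearP scalerDl scalerA.
Qed.

Lemma slice_linear mu : linear (slice mu).
Proof. exact/tens_lift_linear/slice_bilinear. Qed.

Lemma slice_pure mu v u : slice mu (tens_pure v u) = (mu v : K) *: u.
Proof. exact/tens_lift_pure/slice_bilinear. Qed.

Lemma sliceD mu x y : slice mu (x + y) = slice mu x + slice mu y.
Proof. by have := slice_linear mu 1 x y; rewrite !scale1r. Qed.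

Lemma sliceN mu x : slice mu (- x) = - slice mu x.
Proof.
apply/eqP; rewrite -subr_eq0 opprK -sliceD addNr.
have := slice_linear mu (-1) 0 0.
by rewrite !scaleN1r oppr0 addr0 addNr => ->.
Qed.

Lemma pure_linearr v : linear (@tens_pure K V U v).
Proof. by have [+ _] := @tens_pure_bilinear K V U; apply. Qed.
Lemma pure_linearl u : linear ((@tens_pure K V U)^~ u).
Proof. by have [_] := @tens_pure_bilinear K V U; apply. Qed.

HB.instance Definition _ v :=
  GRing.isLinear.Build K U (tens V U) *:%R (@tens_pure K V U v)
    (pure_linearr v).

Lemma pure_suml (I : Type) (r : seq I) (c : I -> K) (f : I -> V) (u : U) :
  tens_pure (\sum_(i <- r) c i *: f i) u =
  \sum_(i <- r) tens_pure (f i) (c i *: u).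
Proof.
elim: r => [|i r IH]; last first.
  rewrite !big_cons pure_linearl IH; congr (_ + _).
  by rewrite linearZ.
rewrite !big_nil; have := pure_linearl u (-1) 0 0.
by rewrite !scaleN1r oppr0 addr0 addNr.
Qed.

Definition frame_slices (fr : seq (functional V * V)) x : tens V U :=
  \sum_(p <- fr) tens_pure p.2 (slice p.1 x).

Lemma frame_slicesD fr x y :
  frame_slices fr (x + y) = frame_slices fr x + frame_slices fr y.
Proof.
rewrite /frame_slices -big_split; apply: eq_bigr => p _ /=.
by rewrite sliceD linearD.
Qed.

Lemma frame_slices_pure fr v u : frame_op fr v = v ->
  frame_slices fr (tens_pure v u) = tens_pure v u.
Proof.
move=> e; rewrite -[in RHS]e pure_suml; apply: eq_bigr => p _.
by rewrite slice_pure.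
Qed.

Lemma frame_slices_id x : exists s, forall fr, frames s fr ->
  frame_slices fr x = x.
Proof.
elim/tens_ind: x => [v u|x y [s xs] [t yt]].
  exists [:: v] => fr sfr; apply: frame_slices_pure.
  by apply: sfr; rewrite inE.
exists (s ++ t) => fr sfr.
by rewrite frame_slicesD xs ?yt // => v vs; apply: sfr; rewrite mem_cat vs ?orbT.
Qed.

(** A tensor is a finite sum, hence is recovered from its slices along a frame
    of the finitely many vectors it involves. *)
Lemma slice_sep x y : (forall mu, slice mu x = slice mu y) -> x = y.
Proof.
move=> e; have [s xs] := frame_slices_id x; have [t yt] := frame_slices_id y.
have [fr sfr] := frame_exists (s ++ t).
rewrite -(xs fr); last by move=> v vs; apply: sfr; rewrite mem_cat vs.
rewrite -(yt fr); last by move=> v vt; apply: sfr; rewrite mem_cat vt orbT.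
by apply: eq_bigr => p _; rewrite e.
Qed.

(** Membership in the image of [span s] tensored with [U]. Being stated by
    annihilators, it is visibly stable under maps of the second factor and
    monotone in [s]. *)
Definition supported (s : seq V) x : Prop :=
  forall mu, (forall v, v \in s -> mu v = 0) -> slice mu x = 0.

Lemma supported_sub s t x : {subset s <= t} -> supported s x -> supported t x.
Proof. by move=> st sx mu mut; apply: sx => v /st/mut. Qed.

Lemma supported_exists x : exists s, supported s x.
Proof.
elim/tens_ind: x => [v u|x y [s xs] [t yt]].
  exists [:: v] => mu muv; rewrite slice_pure muv ?scale0r // inE //.
exists (s ++ t) => mu must; rewrite sliceD xs ?yt ?addr0 // => v vs.
  by apply: must; rewrite mem_cat vs orbT.
by apply: must; rewrite mem_cat vs.
Qed.

Lemma slice_sum_pure mu (I : Type) (r : seq I) (f : I -> V) (u : I -> U) :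
  slice mu (\sum_(i <- r) tens_pure (f i) (u i)) =
  \sum_(i <- r) (mu (f i) : K) *: u i.
Proof.
elim: r => [|i r IH]; last by rewrite !big_cons sliceD slice_pure IH.
rewrite !big_nil; apply/eqP; rewrite -(subrr 0) sliceD sliceN subrr.
by rewrite eqxx.
Qed.

(** The condition on the support is applied to the functional
    [frame_restf fr mu], which vanishes on [s]. *)
Lemma slice_supported s fr mu x : frames s fr -> supported s x ->
  slice mu x = \sum_(p <- fr) (mu p.2 : K) *: slice p.1 x.
Proof.
move=> sfr xs; have e := xs (frame_restf fr mu).
apply/eqP; rewrite -subr_eq0; apply/eqP; rewrite -[RHS]e; last first.
  by move=> v /sfr e'; rewrite /= /frame_rest e' subrr linear0.
elim/tens_ind: (x) => [v u|y z IH IH'].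
  rewrite !slice_pure /= frame_restE scalerBl scaler_suml; congr (_ - _).
  by apply: eq_bigr => p _; rewrite slice_pure scalerA mulrC.
rewrite !sliceD -IH -IH' addrACA -opprD -big_split; congr (_ - _).
by apply: eq_bigr => p _; rewrite sliceD scalerDr.
Qed.

Lemma frame_slices_supported s fr x : frames s fr -> supported s x ->
  frame_slices fr x = x.
Proof.
move=> sfr xs; apply: slice_sep => mu.
by rewrite slice_sum_pure -(slice_supported mu sfr).
Qed.
End Slices.

(** * Jointly injective morphisms *)

Section JointInjectivity.
Variable K : fieldType.
Implicit Types A B C U V : algebra K.

Lemma slice_map A B V (mu : functional V) (f : alg_hom A B)
    (x : tens_alg V A) :
  slice mu (tens_map (alg_id V) f x) = f (slice mu x).
Proof.
elim/tens_alg_ind: x => [v a|x y ex ey].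
  by rewrite tens_mapE !slice_pure linearZ.
by rewrite raddfD /= !sliceD ex ey raddfD.
Qed.

Lemma supported_map A B V (s : seq V) (f : alg_hom A B) (x : tens_alg V A) :
  supported s x -> supported s (tens_map (alg_id V) f x).
Proof. by move=> xs mu mus; rewrite slice_map xs ?raddf0. Qed.

Definition jointly_injective (J : Type) A (U : J -> algebra K)
    (f : forall j, alg_hom A (U j)) : Prop :=
  forall x y, (forall j, f j x = f j y) -> x = y.

(** A slice of the image of a tensor is the image of its slice, and slices
    separate tensors. *)
Lemma tens_mapr_inj J A V (U : J -> algebra K) (f : forall j, alg_hom A (U j)) :
  jointly_injective f -> jointly_injective (fun j => tens_map (alg_id V) (f j)).
Proof.
move=> finj x y e; apply: slice_sep => mu; apply: finj => j.
by rewrite -!slice_map e.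
Qed.

Lemma tens_flipK A B (x : tens_alg A B) : tens_flip B A (tens_flip A B x) = x.
Proof.
rewrite -alg_compE -[RHS]/(alg_id _ x); congr (alg_fun _ x).
by apply: tens_alg_hom_eq => a b; rewrite alg_compE !tens_flipE.
Qed.

Lemma tens_mapl_inj J A V (U : J -> algebra K) (f : forall j, alg_hom A (U j)) :
  jointly_injective f -> jointly_injective (fun j => tens_map (f j) (alg_id V)).
Proof.
move=> finj x y e; rewrite -[x]tens_flipK -[y]tens_flipK.
congr (tens_flip _ _ _).
apply: (tens_mapr_inj finj) => j.
by rewrite -!alg_compE !tens_flip_nat !alg_compE e.
Qed.
End JointInjectivity.

(** * Algebras presented by their morphisms *)

Section Presented.
Variables (K : fieldType) (T : Type).

(** Multiples and sums are merged in [Lin], so that closure under [Lin] is the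
    usual linearity condition [k *: x + y]. *)
Inductive term : Type :=
  | Gen of T
  | One
  | Lin of K & term & term
  | Mul of term & term.

Fixpoint eval (U : algebra K) (v : T -> U) (t : term) : U :=
  match t with
  | Gen a => v a
  | One => 1
  | Lin k t u => k *: eval v t + eval v u
  | Mul t u => eval v t * eval v u
  end.

Variable P : forall U : algebra K, (T -> U) -> Prop.

(** Identifying the expressions that the valuations in [P] do not distinguish
    makes these valuations extend to morphisms, and makes the extensions jointly
    injective, without any description of an ideal of relations. *)
Definition term_rel (t u : term) : Prop :=
  forall (U : algebra K) (v : T -> U), P v -> eval v t = eval v u.

Definition presented : Type := quot term_rel.

HB.instance Definition _ := gen_eqMixin presented.
HB.instance Definition _ := gen_choiceMixin presented.

Implicit Types (x y z : presented) (U : algebra K) (k : K).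

Definition cls (t : term) : presented := quot_class term_rel t.
Definition pres_eval (U : algebra K) (v : T -> U) x : U := eval v (quot_repr x).

Lemma pres_eval_cls (U : algebra K) (v : T -> U) t : P v ->
  pres_eval v (cls t) = eval v t.
Proof.
move=> Pv; apply: (@quot_repr_class _ term_rel _ _ _ t) => //.
- by move=> x y e W w Pw; rewrite e.
- by move=> x y z e e' W w Pw; rewrite e // e'.
Qed.

Lemma pres_sep x y :
  (forall (U : algebra K) (v : T -> U), P v -> pres_eval v x = pres_eval v y) ->
  x = y.
Proof.
move=> e; rewrite -(quot_reprK x) -(quot_reprK y).
apply/quot_eqP => //.
- by move=> t u e' W w Pw; rewrite e'.
- by move=> t u z e' e'' W w Pw; rewrite e' // e''.
Qed.

Definition pres_lin (k : K) x y := cls (Lin k (quot_repr x) (quot_repr y)).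
Definition pres_mul x y := cls (Mul (quot_repr x) (quot_repr y)).
Definition pres_one := cls One.
Definition pres_zero := cls (Lin (-1) One One).
Definition pres_add x y := pres_lin 1 x y.
Definition pres_scale (k : K) x := pres_lin k x pres_zero.
Definition pres_opp x := pres_scale (-1) x.

Lemma pres_eval_lin U (v : T -> U) k x y : P v ->
  pres_eval v (pres_lin k x y) = k *: pres_eval v x + pres_eval v y.
Proof. exact: pres_eval_cls. Qed.
Lemma pres_eval_mul U (v : T -> U) x y : P v ->
  pres_eval v (pres_mul x y) = pres_eval v x * pres_eval v y.
Proof. exact: pres_eval_cls. Qed.
Lemma pres_eval_one U (v : T -> U) : P v -> pres_eval v pres_one = 1.
Proof. exact: pres_eval_cls. Qed.
Lemma pres_eval_zero U (v : T -> U) : P v -> pres_eval v pres_zero = 0.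
Proof. by move=> Pv; rewrite pres_eval_cls //= scaleN1r addNr. Qed.
Lemma pres_eval_add U (v : T -> U) x y : P v ->
  pres_eval v (pres_add x y) = pres_eval v x + pres_eval v y.
Proof. by move=> Pv; rewrite pres_eval_lin // scale1r. Qed.
Lemma pres_eval_scale U (v : T -> U) k x : P v ->
  pres_eval v (pres_scale k x) = k *: pres_eval v x.
Proof. by move=> Pv; rewrite pres_eval_lin // pres_eval_zero // addr0. Qed.
Lemma pres_eval_opp U (v : T -> U) x : P v ->
  pres_eval v (pres_opp x) = - pres_eval v x.
Proof. by move=> Pv; rewrite pres_eval_scale // scaleN1r. Qed.

Definition pres_evalE := (pres_eval_add, pres_eval_scale, pres_eval_opp,
  pres_eval_zero, pres_eval_one, pres_eval_mul).

Lemma pres_addA : associative pres_add.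
Proof. by move=> x y z; apply: pres_sep => U v Pv; rewrite !pres_evalE ?addrA. Qed.
Lemma pres_addC : commutative pres_add.
Proof. by move=> x y; apply: pres_sep => U v Pv; rewrite !pres_evalE // addrC. Qed.
Lemma pres_add0 : left_id pres_zero pres_add.
Proof. by move=> x; apply: pres_sep => U v Pv; rewrite !pres_evalE // add0r. Qed.
Lemma pres_addN : left_inverse pres_zero pres_opp pres_add.
Proof. by move=> x; apply: pres_sep => U v Pv; rewrite !pres_evalE // addNr. Qed.

HB.instance Definition _ := GRing.isZmodule.Build presented
  pres_addA pres_addC pres_add0 pres_addN.

Lemma pres_scaleA a b x : pres_scale a (pres_scale b x) = pres_scale (a * b) x.
Proof. by apply: pres_sep => U v Pv; rewrite !pres_evalE // scalerA. Qed.
Lemma pres_scale1 : left_id 1 pres_scale.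
Proof. by move=> x; apply: pres_sep => U v Pv; rewrite !pres_evalE // scale1r. Qed.
Lemma pres_scaleDr : right_distributive pres_scale +%R.
Proof.
by move=> k x y; apply: pres_sep => U v Pv; rewrite !pres_evalE // scalerDr.
Qed.
Lemma pres_scaleDl x : {morph pres_scale^~ x : a b / a + b}.
Proof.
by move=> a b; apply: pres_sep => U v Pv; rewrite !pres_evalE // scalerDl.
Qed.

HB.instance Definition _ := GRing.Zmodule_isLmodule.Build K presented
  pres_scaleA pres_scale1 pres_scaleDr pres_scaleDl.

Lemma pres_mulA : associative pres_mul.
Proof. by move=> x y z; apply: pres_sep => U v Pv; rewrite !pres_evalE ?mulrA. Qed.
Lemma pres_mul1 : left_id pres_one pres_mul.
Proof. by move=> x; apply: pres_sep => U v Pv; rewrite !pres_evalE // mul1r. Qed.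
Lemma pres_1mul : right_id pres_one pres_mul.
Proof. by move=> x; apply: pres_sep => U v Pv; rewrite !pres_evalE // mulr1. Qed.
Lemma pres_mul_bilinear : bilinear_map pres_mul.
Proof.
split=> [x k y z|z k x y]; apply: pres_sep => U v Pv; rewrite !pres_evalE //.
  by rewrite mulrDr alg_scaleAr.
by rewrite mulrDl alg_scaleAl.
Qed.

Definition pres_alg : algebra K :=
  @Algebra K presented pres_one pres_mul pres_mulA pres_mul1 pres_1mul
    pres_mul_bilinear.

Definition pres_gen (a : T) : pres_alg := cls (Gen a).

Section Lift.
Variables (U : algebra K) (v : T -> U) (Pv : P v).

Lemma pres_lift_linear : linear (pres_eval v : pres_alg -> U).
Proof. by move=> k x y; rewrite !pres_evalE. Qed.
Lemma pres_lift_monoid : monoid_morphism (pres_eval v : pres_alg -> U).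
Proof. by split=> [|x y]; rewrite !pres_evalE. Qed.
Definition pres_lift : alg_hom pres_alg U :=
  AlgHom pres_lift_linear pres_lift_monoid.

Lemma pres_lift_gen a : pres_lift (pres_gen a) = v a.
Proof. exact: pres_eval_cls. Qed.
End Lift.

Lemma pres_inj : jointly_injective
  (fun j : {U : algebra K & {v : T -> U | P v}} => pres_lift (svalP (projT2 j))).
Proof.
move=> x y e; apply: pres_sep => U v Pv.
exact: (e (existT _ U (exist _ v Pv))).
Qed.

Lemma pres_ind (Q : pres_alg -> Prop) : Q 1 ->
  (forall k (x y : pres_alg), Q x -> Q y -> Q (k *: x + y)) ->
  (forall x y : pres_alg, Q x -> Q y -> Q (x * y)) ->
  (forall a, Q (pres_gen a)) -> forall x, Q x.
Proof.
move=> Q1 QL QM QG; apply: quot_ind; elim=> [a||k t Qt u Qu|t Qt u Qu].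
- exact: QG.
- exact: Q1.
- suff -> : quot_class term_rel (Lin k t u) =
      (k *: (cls t : pres_alg) + (cls u : pres_alg)) :> pres_alg by apply: QL.
  by apply: pres_sep => U v Pv; rewrite !pres_evalE // !pres_eval_cls.
- suff -> : quot_class term_rel (Mul t u) =
      ((cls t : pres_alg) * (cls u : pres_alg)) :> pres_alg by apply: QM.
  by apply: pres_sep => U v Pv; rewrite !pres_evalE // !pres_eval_cls.
Qed.

Lemma pres_hom_eq U (f g : alg_hom pres_alg U) :
  (forall a, f (pres_gen a) = g (pres_gen a)) -> f = g.
Proof.
move=> e; apply: alg_homP; apply: pres_ind => // [|k x y ex ey|x y ex ey].
- by rewrite !rmorph1.
- by rewrite !alg_hom_linear ex ey.
- by rewrite (alg_hom_monoid f).2 (alg_hom_monoid g).2 ex ey.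
Qed.
End Presented.

(** * Families of comodule morphisms *)

Section Families.
Variables (K : fieldType) (H : hopf_algebra K).
Implicit Types (V W : comodule H) (U : algebra K).

Lemma tens_map_compE (A A' A'' B B' B'' : algebra K) (f' : alg_hom A' A'')
    (f : alg_hom A A') (g' : alg_hom B' B'') (g : alg_hom B B')
    (x : tens_alg A B) :
  tens_map f' g' (tens_map f g x) =
  tens_map (alg_comp f' f) (alg_comp g' g) x.
Proof. by rewrite tens_map_comp. Qed.

Lemma tens_assoc_natE (A A' B B' C C' : algebra K) (f : alg_hom A A')
    (g : alg_hom B B') (h : alg_hom C C') (x : tens_alg (tens_alg A B) C) :
  tens_map f (tens_map g h) (tens_assoc A B C x) =
  tens_assoc A' B' C' (tens_map (tens_map f g) h x).
Proof. by rewrite -!alg_compE tens_assoc_nat. Qed.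

(** Of the two sides of the family equation at [w], this one is a function of the
    value of the family at [w], while [coact_right] needs the whole family. *)
Definition coact_left V U (x : tens_alg V U) : tens_alg V (tens_alg U H) :=
  tens_map (alg_id V) (tens_flip H U)
    (tens_assoc V H U (tens_map (coact V) (alg_id U) x)).

Definition coact_right W V U (phi : alg_hom W (tens_alg V U)) (w : W) :
    tens_alg V (tens_alg U H) :=
  tens_assoc V U H (tens_map phi (alg_id H) (coact W w)).

Lemma is_familyP W V U (phi : alg_hom W (tens_alg V U)) :
  is_family phi <-> forall w, coact_left (phi w) = coact_right phi w.
Proof.
split=> [e w|e]; last by apply: alg_homP => w; apply: e.
exact: (congr1 (fun f : alg_hom W (tens_alg V (tens_alg U H)) => f w) e).
Qed.

Lemma coact_left_nat V U U' (f : alg_hom U U') (x : tens_alg V U) :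
  coact_left (tens_map (alg_id V) f x) =
  tens_map (alg_id V) (tens_map f (alg_id H)) (coact_left x).
Proof.
rewrite /coact_left !tens_map_compE tens_flip_nat -!tens_map_compE.
rewrite tens_assoc_natE !tens_map_compE tens_map_id.
by rewrite alg_comp_idl !alg_comp_idr.
Qed.

Lemma coact_right_nat W V U U' (f : alg_hom U U')
    (phi : alg_hom W (tens_alg V U)) (w : W) :
  coact_right (alg_comp (tens_map (alg_id V) f) phi) w =
  tens_map (alg_id V) (tens_map f (alg_id H)) (coact_right phi w).
Proof.
by rewrite /coact_right tens_assoc_natE tens_map_compE alg_comp_idr.
Qed.

Lemma family_push W V U U' (f : alg_hom U U')
    (phi : alg_hom W (tens_alg V U)) :
  is_family phi -> is_family (alg_comp (tens_map (alg_id V) f) phi).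
Proof.
move=> /is_familyP e; apply/is_familyP => w.
by rewrite coact_right_nat -e alg_compE coact_left_nat.
Qed.

Lemma family_pull W W' V V' U (g : com_hom W W') (f : com_hom V' V)
    (phi : alg_hom W' (tens_alg V' U)) :
  is_family phi ->
  is_family (alg_comp (alg_comp (tens_map f (alg_id U)) phi) g).
Proof.
move=> /is_familyP e; apply/is_familyP => w; rewrite !alg_compE.
have -> : coact_right (alg_comp (alg_comp (tens_map f (alg_id U)) phi) g) w =
    tens_map f (tens_map (alg_id U) (alg_id H)) (coact_right phi (g w)).
  rewrite /coact_right tens_assoc_natE com_hom_coact !tens_map_compE.
  by rewrite !alg_comp_idr.
rewrite -e /coact_left tens_map_compE.
have -> : alg_comp (coact V) f =
    alg_comp (tens_map f (alg_id H)) (coact V').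
  by apply: alg_homP => v; apply: com_hom_coact.
rewrite -[X in tens_map (alg_comp _ _) X]alg_comp_idl -!tens_map_compE.
by rewrite -tens_assoc_natE !tens_map_compE !tens_map_id !alg_comp_idl alg_comp_idr.
Qed.

Lemma tens_inl_linear (A B : algebra K) :
  linear (fun a => tpure a (1 : B) : tens_alg A B).
Proof. by have [_] := @tpure_bilinear K A B; apply. Qed.
Lemma tens_inl_monoid (A B : algebra K) :
  monoid_morphism (fun a => tpure a (1 : B) : tens_alg A B).
Proof. by split=> // a a'; rewrite tpureM mulr1. Qed.
Definition tens_inl (A B : algebra K) : alg_hom A (tens_alg A B) :=
  AlgHom (@tens_inl_linear A B) (@tens_inl_monoid A B).

Lemma tens_runit_inl (A : algebra K) (a : A) :
  tens_runit A (tens_inl A (ground K) a) = a.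
Proof. by rewrite tens_runitE scale1r. Qed.

Lemma tens_inl_runit (A : algebra K) (x : tens_alg A (ground K)) :
  tens_inl A (ground K) (tens_runit A x) = x.
Proof.
rewrite -alg_compE -[RHS]/(alg_id _ x); congr (alg_fun _ x).
apply: tens_alg_hom_eq => a k; rewrite alg_compE tens_runitE.
have -> : alg_id _ (tpure a k) = (k : K) *: tpure a (1 : ground K).
  rewrite -(bilin_scaler _ _ _ (@tpure_bilinear K A (ground K))).
  by congr tpure; rewrite /GRing.scale /= mulr1.
by rewrite linearZ.
Qed.

Definition insert_unit V :
    alg_hom (tens_alg V H) (tens_alg V (tens_alg (ground K) H)) :=
  tens_map (alg_id V)
    (alg_comp (tens_flip H (ground K)) (tens_inl H (ground K))).

Lemma insert_unit_inj V : injective (insert_unit V).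
Proof.
apply: (can_inj (g := tens_map (alg_id V)
  (alg_comp (tens_runit H) (tens_flip (ground K) H)))) => x.
rewrite /insert_unit tens_map_compE -[RHS]/(alg_id _ x); congr (alg_fun _ x).
apply: tens_alg_hom_eq => v h; rewrite tens_mapE; congr tpure.
by rewrite !alg_compE tens_flipK tens_runit_inl.
Qed.

Lemma coact_left_inl V (v : V) :
  coact_left (tens_inl V (ground K) v) = insert_unit V (coact V v).
Proof.
rewrite /coact_left.
have -> : tens_map (coact V) (alg_id (ground K)) (tens_inl V (ground K) v) =
    tens_inl (tens_alg V H) (ground K) (coact V v) by apply: tens_mapE.
move: (coact V v) => x; rewrite -!alg_compE.
congr (alg_fun _ x); apply: tens_alg_hom_eq => u h.
by rewrite !alg_compE tens_assocE !tens_mapE.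
Qed.

Lemma coact_right_inl W V (f : alg_hom W V) (w : W) :
  coact_right (alg_comp (tens_inl V (ground K)) f) w =
  insert_unit V (tens_map f (alg_id H) (coact W w)).
Proof.
rewrite /coact_right.
have -> : tens_map (alg_comp (tens_inl V (ground K)) f) (alg_id H) (coact W w) =
    tens_map (tens_inl V (ground K)) (alg_id H)
      (tens_map f (alg_id H) (coact W w)) by rewrite tens_map_compE alg_comp_idl.
move: (tens_map f _ _) => x; rewrite -!alg_compE.
congr (alg_fun _ x); apply: tens_alg_hom_eq => u h.
by rewrite !alg_compE !tens_mapE tens_assocE !alg_compE tens_flipE.
Qed.

(** Both sides of the family equation for [tens_inl \o f] are the images of the
    two sides of the comodule morphism equation for [f] under the injection
    [insert_unit]: families over the ground field are comodule morphisms. *)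
Lemma family_inl W V (f : alg_hom W V) :
  is_family (alg_comp (tens_inl V (ground K)) f) <->
  forall w, coact V (f w) = tens_map f (alg_id H) (coact W w).
Proof.
rewrite is_familyP; split=> e w; last first.
  by rewrite coact_right_inl alg_compE coact_left_inl e.
by apply: (@insert_unit_inj V); rewrite -coact_left_inl -coact_right_inl -e.
Qed.
End Families.

(** * The universal family with prescribed support *)

Definition generating (K : fieldType) (A : algebra K) (I : Type) (g : I -> A) :
    Prop :=
  forall P : A -> Prop, P 1 ->
    (forall (k : K) x y, P x -> P y -> P (k *: x + y)) ->
    (forall x y, P x -> P y -> P (x * y)) -> (forall i, P (g i)) ->
    forall a, P a.

Section Universal.
Variables (K : fieldType) (H : hopf_algebra K) (W V : comodule H).
Variables (I : Type) (g : I -> W) (s : seq V).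

Hypothesis g_gen : generating g.

Implicit Types U : algebra K.

Definition adapted U (phi : alg_hom W (tens_alg V U)) : Prop :=
  is_family phi /\ forall i, supported s (phi (g i)).

Lemma adapted_push U U' (f : alg_hom U U') (phi : alg_hom W (tens_alg V U)) :
  adapted phi -> adapted (alg_comp (tens_map (alg_id V) f) phi).
Proof.
by case=> fam supp; split=> [|i]; [exact: family_push|exact/supported_map/supp].
Qed.

Definition slices U (phi : alg_hom W (tens_alg V U))
    (p : functional V * I) : U :=
  slice p.1 (phi (g p.2)).

Definition slices_adapted U (v : functional V * I -> U) : Prop :=
  exists phi, adapted phi /\ v = slices phi.

Definition rep_alg : algebra K := pres_alg slices_adapted.

Section Lift.
Variables (U : algebra K) (phi : alg_hom W (tens_alg V U)) (phiA : adapted phi).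
Definition rep_lift : alg_hom rep_alg U :=
  pres_lift (ex_intro _ phi (conj phiA erefl) : slices_adapted (slices phi)).
Lemma rep_lift_gen p : rep_lift (pres_gen _ p) = slices phi p.
Proof. exact: pres_lift_gen. Qed.
End Lift.

Definition adapted_family : Type :=
  {U : algebra K & {phi : alg_hom W (tens_alg V U) | adapted phi}}.
Definition rep_homs (j : adapted_family) : alg_hom rep_alg (projT1 j) :=
  rep_lift (svalP (projT2 j)).

(** This stands in for an explicit knowledge of the relations in [rep_alg]. *)
Lemma rep_inj : jointly_injective rep_homs.
Proof.
move=> x y e; apply: pres_inj => -[U [v Pv]] /=.
have [phi [phiA ev]] := Pv; subst v.
exact: (e (existT _ U (exist _ phi phiA))).
Qed.

Lemma rep_tens_eq (x y : tens_alg V rep_alg) :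
  (forall U (phi : alg_hom W (tens_alg V U)) (phiA : adapted phi),
    tens_map (alg_id V) (rep_lift phiA) x =
    tens_map (alg_id V) (rep_lift phiA) y) -> x = y.
Proof. by move=> e; apply: (tens_mapr_inj rep_inj) => j; apply: e. Qed.

Lemma frame_slices_rep fr U (phi : alg_hom W (tens_alg V U))
    (phiA : adapted phi) i : frames s fr ->
  tens_map (alg_id V) (rep_lift phiA)
    (\sum_(p <- fr) tpure p.2 (pres_gen slices_adapted (p.1, i))) = phi (g i).
Proof.
move=> sfr; rewrite linear_sum -[RHS](frame_slices_supported sfr (phiA.2 i)).
apply: eq_bigr => p _; apply: etrans; first exact: tens_mapE.
by rewrite rep_lift_gen.
Qed.

(** The value of the universal family at [w] is characterized by specializing to
    the value of every family. Such elements can be added and multiplied, and at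
    the generators they are sums over a frame of [s]. *)
Lemma rep_val_exists (w : W) : exists x : tens_alg V rep_alg,
  forall U (phi : alg_hom W (tens_alg V U)) (phiA : adapted phi),
    tens_map (alg_id V) (rep_lift phiA) x = phi w.
Proof.
elim/g_gen: w => [|k w w' [x ex] [x' ex']|w w' [x ex] [x' ex']|i].
- by exists 1 => U phi phiA; rewrite !rmorph1.
- exists (k *: x + x') => U phi phiA.
  by rewrite alg_hom_linear ex ex' alg_hom_linear.
- exists (x * x') => U phi phiA.
  by rewrite (alg_hom_monoid _).2 ex ex' (alg_hom_monoid phi).2.
- have [fr sfr] := frame_exists s.
  exists (\sum_(p <- fr) tpure p.2 (pres_gen _ (p.1, i))).
  by move=> U phi phiA; apply: frame_slices_rep.
Qed.

Definition rep_val (w : W) : tens_alg V rep_alg := sval (cid (rep_val_exists w)).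

Lemma rep_valE (w : W) U (phi : alg_hom W (tens_alg V U)) (phiA : adapted phi) :
  tens_map (alg_id V) (rep_lift phiA) (rep_val w) = phi w.
Proof. by rewrite /rep_val; case: cid. Qed.

Lemma rep_val_linear : linear rep_val.
Proof.
move=> k x y; apply: rep_tens_eq => U phi phiA.
by rewrite alg_hom_linear !rep_valE alg_hom_linear.
Qed.
Lemma rep_val_monoid : monoid_morphism rep_val.
Proof.
split=> [|x y]; apply: rep_tens_eq => U phi phiA.
  by rewrite rep_valE !rmorph1.
by rewrite (alg_hom_monoid _).2 !rep_valE (alg_hom_monoid phi).2.
Qed.

Definition rep_family : alg_hom W (tens_alg V rep_alg) :=
  AlgHom rep_val_linear rep_val_monoid.

Lemma rep_familyE U (phi : alg_hom W (tens_alg V U)) (phiA : adapted phi) :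
  alg_comp (tens_map (alg_id V) (rep_lift phiA)) rep_family = phi.
Proof. by apply: alg_homP => w; apply: rep_valE. Qed.

Lemma slice_rep_family (mu : functional V) i :
  slice mu (rep_family (g i)) = pres_gen slices_adapted (mu, i).
Proof.
apply: rep_inj => -[U [phi phiA]].
by rewrite -slice_map rep_lift_gen rep_valE.
Qed.

(** The family equation lives in [V ⊗ (rep_alg ⊗ H)]; by joint injectivity it is
    tested on the families themselves. *)
Lemma rep_family_adapted : adapted rep_family.
Proof.
split=> [|i mu mus].
  apply/is_familyP => w.
  apply: (tens_mapr_inj (tens_mapl_inj rep_inj)) => -[U [phi phiA]].
  rewrite -coact_left_nat -coact_right_nat rep_familyE rep_valE.
  by have /is_familyP := phiA.1; apply.
apply: rep_inj => -[U [phi phiA]].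
by rewrite -slice_map rep_valE raddf0 (phiA.2 i).
Qed.

(** A morphism out of [rep_alg] is determined on the symbols, which are the slices
    of [rep_family] at the generators. *)
Lemma rep_universal U (phi : alg_hom W (tens_alg V U)) : adapted phi ->
  exists! f : alg_hom rep_alg U,
    phi = alg_comp (tens_map (alg_id V) f) rep_family.
Proof.
move=> phiA; exists (rep_lift phiA); split=> [|f e]; first by rewrite rep_familyE.
apply: pres_hom_eq => -[mu i]; rewrite rep_lift_gen /slices e alg_compE.
by rewrite slice_map slice_rep_family.
Qed.

End Universal.

(** The slices along the finitely many functionals of a frame of [s] determine
    all the others. *)
Lemma rep_fin_gen (K : fieldType) (H : hopf_algebra K) (W V : comodule H)
    (I : finType) (g : I -> W) (s : seq V) :
  generating g -> fin_gen (rep_alg g s).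
Proof.
move=> g_gen; have [fr sfr] := frame_exists s.
exists [seq pres_gen _ (p.1, i) | p <- fr, i <- enum I] => P P1 PL PM Pg.
have P0 : P 0 by rewrite -(addNr (1 : rep_alg g s)) -scaleN1r; apply: PL.
apply: pres_ind => // -[mu i].
rewrite -(slice_rep_family s g_gen).
rewrite (slice_supported mu sfr ((rep_family_adapted s g_gen).2 i)).
elim: fr Pg {sfr} => [|p fr IH] Pg; first by rewrite big_nil.
rewrite big_cons; apply: PL; last first.
  by apply: IH => x xfr; apply: Pg; rewrite mem_cat xfr orbT.
rewrite slice_rep_family; apply: Pg; rewrite mem_cat; apply/orP; left.
by apply: (map_f (fun i => pres_gen _ (p.1, i))); rewrite mem_enum.
Qed.

(** * Functors from universal elements *)

Definition fully_faithful (C D : category) (J : functor C D) : Prop :=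
  forall (a b : C) (u : mor (J a) (J b)), exists! v : mor a b, fmap J v = u.

Lemma id_functor_ff (C : category) : fully_faithful (id_functor C).
Proof. by move=> a b u; exists u; split. Qed.

(** Pro-morphisms between pro-objects of a full subcategory are the same in the
    subcategory and in the ambient category: both are built from the same germs,
    which [fmap] reproduces up to a change of representatives. *)
Lemma pro_functor_incl_ff (C : category) (P : C -> Prop) :
  fully_faithful (pro_functor (full_incl P)).
Proof.
move=> a b u.
have fmap_eq (v : pro_hom a b) :
    (forall j, v j = u j :> @germ C (pro_fobj (full_incl P) a) (sval (b j))) ->
    fmap (pro_functor (full_incl P)) v = u.
  move=> e; apply: pro_homP => j; rewrite -e /=.
  by elim/germ_ind: (v j) => i t; rewrite germ_fmapE.
pose v : pro_hom a b :=
  @ProHom (full_sub P) a b (fun j => u j) (@pro_germ_tr _ _ _ u).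
exists v; split=> [|w e]; first exact: fmap_eq.
apply: pro_homP => j; rewrite /= -e /=.
by elim/germ_ind: (w j) => i t; rewrite germ_fmapE.
Qed.

(** In the applications [x] is a pair of comodules [(W, V)], [F x U] consists of
    the morphisms [W -> V ⊗ U], and [good] singles out the families among them.
    The functor [J] allows the representing objects to be taken in a full
    subcategory. *)
Section Representable.
Variables (X E E' : category) (J : functor E E').
Hypothesis J_ff : fully_faithful J.

Variable F : X -> E' -> Type.
Variable push : forall x (U U' : E'), mor U U' -> F x U -> F x U'.
Variable pull : forall (x y : X) U, mor x y -> F y U -> F x U.
Hypothesis push_id : forall x U (p : F x U), push (idm U) p = p.
Hypothesis push_comp : forall x U U' U'' (u' : mor U' U'') (u : mor U U')
  (p : F x U), push (u' ∘ u) p = push u' (push u p).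
Hypothesis pull_id : forall x U (p : F x U), pull (idm x) p = p.
Hypothesis pull_comp : forall x y z U (m' : mor y z) (m : mor x y) (p : F z U),
  pull (m' ∘ m) p = pull m (pull m' p).
Hypothesis pull_push : forall x y U U' (m : mor x y) (u : mor U U') (p : F y U),
  pull m (push u p) = push u (pull m p).

Variable good : forall x U, F x U -> Prop.
Hypothesis good_pull : forall x y U (m : mor x y) (p : F y U),
  good p -> good (pull m p).
Hypothesis good_push : forall x U U' (u : mor U U') (p : F x U),
  good p -> good (push u p).

Definition universal_element x (a : E) (h : F x (J a)) : Prop :=
  good h /\ forall U (p : F x U), good p -> exists! u : mor (J a) U, p = push u h.

(** A morphism acts through the unique factorization of the pulled back universal
    element; uniqueness gives the functor laws. *)
Lemma universal_functor :
  (forall x, exists (a : E) (h : F x (J a)), universal_element h) ->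
  exists (A : functor X E) (h : forall x, F x (J (A x))),
    (forall x, universal_element (h x)) /\
    (forall x y (m : mor x y), push (fmap J (fmap A m)) (h x) = pull m (h y)).
Proof.
move=> rep; pose A0 x : E := projT1 (cid (rep x)).
pose h x : F x (J (A0 x)) := projT1 (cid (projT2 (cid (rep x)))).
have hU x : universal_element (h x) := projT2 (cid (projT2 (cid (rep x)))).
have tr_exists x y (m : mor x y) :
    exists v : mor (A0 x) (A0 y), push (fmap J v) (h x) = pull m (h y).
  have [u [eu _]] := (hU x).2 _ _ (good_pull m (hU y).1).
  by have [v [ev _]] := J_ff u; exists v; rewrite ev.
pose tr x y (m : mor x y) : mor (A0 x) (A0 y) := projT1 (cid (tr_exists x y m)).
have trP x y (m : mor x y) : push (fmap J (tr x y m)) (h x) = pull m (h y).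
  exact: projT2 (cid (tr_exists x y m)).
have tr_uniq x b (v v' : mor (A0 x) b) :
    good (push (fmap J v) (h x)) ->
    push (fmap J v) (h x) = push (fmap J v') (h x) -> v = v'.
  move=> gv e; have [u [_ u_uniq]] := (hU x).2 _ _ gv.
  have e' : fmap J v = fmap J v' by rewrite -(u_uniq _ erefl) -(u_uniq _ e).
  have [w [_ w_uniq]] := J_ff (fmap J v).
  by rewrite -(w_uniq v erefl) -(w_uniq v' (esym e')).
have tr_good x y (m : mor x y) : good (push (fmap J (tr x y m)) (h x)).
  by rewrite trP; apply: good_pull; case: (hU y).
have tr_id x : tr x x (idm x) = idm (A0 x).
  by apply: tr_uniq => //; rewrite trP fmap_id push_id pull_id.
have tr_comp x y z (m' : mor y z) (m : mor x y) :
    tr x z (m' ∘ m) = tr y z m' ∘ tr x y m.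
  apply: tr_uniq => //.
  by rewrite trP fmap_comp push_comp trP -pull_push trP pull_comp.
by exists (Functor tr_id tr_comp), h.
Qed.

(** Here [G] is another description, by way of [c], of the good elements over one
    object [k]; by universality these are the morphisms to [k]. *)
Lemma universal_bijection (A : functor X E) (h : forall x, F x (J (A x)))
    (k : E') (G : X -> Type) (Gmap : forall x y, mor x y -> G y -> G x)
    (c : forall x, G x -> F x k) :
  (forall x, universal_element (h x)) ->
  (forall x y (m : mor x y), push (fmap J (fmap A m)) (h x) = pull m (h y)) ->
  (forall x t, good (c x t)) -> (forall x, injective (c x)) ->
  (forall x (p : F x k), good p -> exists t, c x t = p) ->
  (forall x y (m : mor x y) t, c x (Gmap x y m t) = pull m (c y t)) ->
  exists b : forall x, G x -> mor (J (A x)) k,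
    (forall x, bijective (b x)) /\
    (forall x y (m : mor x y) t,
       b x (Gmap x y m t) = b y t ∘ fmap J (fmap A m)).
Proof.
move=> hU hN c_good c_inj c_surj c_nat.
have b_exists x t : exists u : mor (J (A x)) k, c x t = push u (h x).
  by have [u [e _]] := (hU x).2 _ _ (c_good x t); exists u.
pose b x t := projT1 (cid (b_exists x t)).
have bP x t : c x t = push (b x t) (h x) := projT2 (cid (b_exists x t)).
have u_uniq x t (u : mor (J (A x)) k) : c x t = push u (h x) -> b x t = u.
  move=> e; have [v [_ v_uniq]] := (hU x).2 _ _ (c_good x t).
  by rewrite -(v_uniq _ (bP x t)) -(v_uniq _ e).
have b_surj x (u : mor (J (A x)) k) : exists t, b x t = u.
  have [t et] := c_surj _ _ (good_push u (hU x).1).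
  by exists t; apply: u_uniq.
exists b; split=> [x|x y m t].
  exists (fun u => projT1 (cid (b_surj x u))) => [t|u].
    by apply: (c_inj x); rewrite !bP; case: cid => t' /= ->.
  exact: projT2 (cid (b_surj x u)).
by apply: u_uniq; rewrite c_nat bP pull_push -hN push_comp.
Qed.
End Representable.

(** * The mapping functor of finite dimensional comodules *)

Section Finite.
Variables (K : fieldType) (H : hopf_algebra K).

Local Notation Alg := (alg_cat K).
Local Notation tens := (tens_functor K).
Local Notation X := (prod_cat (com_cat H) (op_cat (com_fd_cat H))).

Let F (x : X) (U : Alg) : Type :=
  @mor Alg (com_alg x.1) (tens (com_alg (sval x.2) : Alg, U)).
Let push (x : X) (U U' : Alg) (u : mor U U') (p : F x U) : F x U' :=
  bimap tens (idm (com_alg (sval x.2) : Alg)) u ∘ p.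
Let pull (x y : X) (U : Alg) (m : mor x y) (p : F y U) : F x U :=
  bimap tens (com_fun m.2) (idm U) ∘ p ∘ com_fun m.1.
Let good (x : X) (U : Alg) (p : F x U) : Prop := is_family p.

Lemma fin_universal_exists (x : X) : exists (a : Alg) (h : F x a),
  universal_element (J := id_functor Alg) push good h.
Proof.
case: x => W [V [s sV]].
have gen : generating (id : com_alg W -> com_alg W) by [].
(* The spanning sequence [s] supports everything, so all of [W] may serve as
   generators. *)
have adaptedP (U : algebra K) (p : alg_hom W (tens_alg V U)) :
    is_family p -> adapted id s p.
  move=> fam; split=> // w mu mus.
  have mu0 v : mu v = 0%R.
    have [c ->] := sV v; rewrite linear_sum big1 // => i _.
    by rewrite linearZ /= mus ?scaler0 // mem_nth.
  elim/tens_alg_ind: (p w) => [v u|y z ey ez]; last first.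
    by rewrite sliceD ey ez addr0.
  by rewrite slice_pure mu0 scale0r.
exists (rep_alg id s), (rep_family s gen); split.
  exact: (rep_family_adapted s gen).1.
move=> U p fam; exact: (rep_universal gen (adaptedP _ _ fam)).
Qed.

Lemma finite_mapping_functor :
  exists (A : functor X Alg)
      (h : forall (W : com_cat H) (V : com_fd_cat H),
         @mor Alg (com_alg W) (tens (com_alg (sval V), A (W, V)))),
    universal_families h /\ natural_families h /\
    let M : functor (prod_cat (op_cat (gscheme_fnt_cat H)) (gscheme_cat H))
              (scheme_cat K) := induced_op A in
    natural_bijection (gmaps_fnt H) (functor_comp (points K) M).
Proof.
have push_id x U (p : F x U) : push (idm U) p = p.
  by rewrite /push bimap_id comp_idl.
have push_comp x U U' U'' (u' : mor U' U'') (u : mor U U') (p : F x U) :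
    push (u' ∘ u) p = push u' (push u p).
  rewrite /push comp_assoc -bimap_comp comp_idl //.
have pull_id x U (p : F x U) : pull (idm x) p = p.
  by rewrite -[RHS](comp_idr (c := Alg)) -[in RHS](comp_idl p) -bimap_id.
have pull_comp x y z U (m' : mor y z) (m : mor x y) (p : F z U) :
    pull (m' ∘ m) p = pull m (pull m' p).
  rewrite /pull !comp_assoc -bimap_comp comp_idl //.
have pull_push x y U U' (m : mor x y) (u : mor U U') (p : F y U) :
    pull m (push u p) = push u (pull m p).
  by rewrite /pull /push !comp_assoc -!bimap_comp !comp_idl !comp_idr.
have good_pull x y U (m : mor x y) (p : F y U) : good p -> good (pull m p).
  exact: family_pull.
have good_push x U U' (u : mor U U') (p : F x U) : good p -> good (push u p).
  exact: family_push.
have [A [h [hU hN]]] := universal_functor (J := id_functor Alg)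
  (@id_functor_ff Alg)
  push_id push_comp pull_id pull_comp pull_push good_pull fin_universal_exists.
exists A, (fun W V => h (W, V)); split; first by move=> W V; exact: (hU (W, V)).
split; first by move=> W W' V V' g f; exact: (hN (W, V) (W', V') (g, f)).
move=> M.
pose G (x : X) : Type := com_hom x.1 (sval x.2).
pose Gmap (x y : X) (m : mor x y) (t : G y) : G x :=
  com_comp m.2 (com_comp t m.1).
pose c (x : X) (t : G x) : F x (ground K) :=
  alg_comp (tens_inl (com_alg (sval x.2)) (ground K)) (com_fun t).
have c_good x t : good (c x t) by apply/family_inl => w; apply: com_hom_coact.
have c_inj x : injective (c x).
  move=> t t' e; apply/com_homP/alg_homP => w.
  rewrite -[LHS]tens_runit_inl -[RHS]tens_runit_inl.
  by rewrite -[tens_inl _ _ _]/(c x t w) e.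
have c_surj x (p : F x (ground K)) : good p -> exists t, c x t = p.
  move=> gp; pose f := alg_comp (tens_runit _) p.
  have ef : alg_comp (tens_inl _ (ground K)) f = p.
    by apply: alg_homP => w; rewrite !alg_compE tens_inl_runit.
  have fC w : coact _ (f w) = tens_map f (alg_id H) (coact _ w).
    by apply/family_inl: w; rewrite ef.
  by exists (ComHom fC).
have c_nat x y (m : mor x y) t : c x (Gmap x y m t) = pull m (c y t).
  apply: alg_homP => w; rewrite /c /Gmap /pull.
  by symmetry; apply: tens_mapE.
have [b [b_bij b_nat]] := universal_bijection push_comp pull_push good_push
  hU hN c_good c_inj c_surj c_nat.
exists (fun S => b (S.2, S.1)); split=> [S|S S' f t]; first exact: b_bij.
rewrite -[RHS](b_nat (S'.2, S'.1) (S.2, S.1) (f.2, f.1)).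
congr (b _ _); apply: com_homP; exact: alg_homP.
Qed.
End Finite.

(** * Representatives of pro-morphisms *)

Section Represents.
Variable C : category.
Implicit Types X Y Z : pro_obj C.

(** Computing with pro-morphisms is reduced to computing with representatives of
    their components: the lemmas below give representatives of composites and of
    tensor products from representatives of the parts. *)
Definition represents X Y (f : pro_hom X Y) j i (t : mor (X i) (Y j)) : Prop :=
  f j = germ_of t.

Lemma represents_exists X Y (f : pro_hom X Y) j :
  exists i (t : mor (X i) (Y j)), represents f t.
Proof. by exists (germ_lvl (f j)), (germ_map (f j)); rewrite /represents germK. Qed.

Lemma represents_id X i : represents (pro_id X) (idm (X i)).
Proof. by []. Qed.

Lemma represents_comp X Y Z (g : pro_hom Y Z) (f : pro_hom X Y) k j i
    (t : mor (Y j) (Z k)) (s : mor (X i) (Y j)) :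
  represents g t -> represents f s -> represents (pro_comp g f) (t ∘ s).
Proof.
by rewrite /represents /= => -> fs; rewrite pro_comp_germE fs germ_pushE.
Qed.

Lemma represents_const (A B : C) (f : mor A B) i j :
  @represents (pro_const A) (pro_const B) (pro_const_map f) j i f.
Proof. by case: i; case: j. Qed.

(** A germ on an object of [C] is the class of a single morphism, so that choosing
    a representative loses nothing here. *)
Definition component (A : C) Y (f : pro_hom (pro_const A) Y) j : mor A (Y j) :=
  germ_map (f j).

Lemma germ_const_irr (A D : C) (i i' : unit) (t : mor A D) :
  @germ_of _ (pro_const A) D i t = @germ_of _ (pro_const A) D i' t.
Proof. by case: i; case: i'. Qed.

Lemma represents_component (A : C) Y (f : pro_hom (pro_const A) Y) j i :
  @represents (pro_const A) Y f j i (component f j).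
Proof.
rewrite /represents -[LHS]germK /component; exact: germ_const_irr.
Qed.

Lemma component_eq (A : C) Y (f : pro_hom (pro_const A) Y) j i
    (t : mor A (Y j)) :
  @represents (pro_const A) Y f j i t -> component f j = t.
Proof.
rewrite /represents (represents_component f j i) => /germ_eqP[k [h [h' e]]].
by move: e; rewrite /= !comp_idr.
Qed.

Lemma component_inj (A : C) Y (f g : pro_hom (pro_const A) Y) :
  (forall j, component f j = component g j) -> f = g.
Proof.
move=> e; apply: pro_homP => j.
by rewrite (represents_component f j tt) (represents_component g j tt) e.
Qed.

Lemma component_tr (A : C) Y (f : pro_hom (pro_const A) Y) i j
    (h : dir_le i j) :
  pro_tr Y h ∘ component f j = component f i.
Proof.
symmetry; apply: (@component_eq _ _ _ _ tt); rewrite /represents.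
by rewrite -(pro_germ_tr f h) (represents_component f j tt) germ_pushE.
Qed.

Section Cone.
Variables (A : C) (Y : pro_obj C) (t : forall j, mor A (Y j)).
Hypothesis t_tr : forall i j (h : dir_le i j), pro_tr Y h ∘ t j = t i.
Let germ_at j := @germ_of _ (pro_const A) (Y j) tt (t j).
Lemma cone_tr i j (h : dir_le i j) :
  germ_push (pro_tr Y h) (germ_at j) = germ_at i.
Proof. by rewrite germ_pushE t_tr. Qed.
Definition cone : pro_hom (pro_const A) Y := ProHom cone_tr.
Lemma component_cone j : component cone j = t j.
Proof. exact: (@component_eq _ _ _ _ tt). Qed.
End Cone.
End Represents.

Lemma represents_bimap (C D E : category) (F : functor (prod_cat C D) E)
    (X X' : pro_obj C) (Y Y' : pro_obj D) (f : pro_hom X X') (g : pro_hom Y Y')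
    i i' j j' (s : mor (X i) (X' i')) (t : mor (Y j) (Y' j')) :
  represents f s -> represents g t ->
  @represents E (pro_bobj F X Y) (pro_bobj F X' Y') (pro_bimap F f g)
    (i', j') (i, j) (bimap F s t).
Proof. by rewrite /represents /= => -> ->; rewrite germ_bimapE. Qed.

(** * Families over pro-algebras *)

Section ProFamilies.
Variables (K : fieldType) (H : hopf_algebra K).

Local Notation Alg := (alg_cat K).
Local Notation tens := (tens_functor K).
Local Notation ptens := (pro_tens_functor K).
Local Notation cst A := (pro_unit Alg A).

Implicit Types (W V : comodule H) (U : pro_obj Alg).

Definition pro_fam W V U : Type :=
  @mor (pro_cat Alg) (cst W) (ptens (cst V, U)).

Definition fam_at W V U (phi : pro_fam W V U) (j : pro_idx U) :
    alg_hom W (tens_alg V (U j)) :=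
  @component Alg W (pro_bobj tens (cst V) U) phi (tt, j).

Lemma fam_at_inj W V U (phi psi : pro_fam W V U) :
  (forall j, fam_at phi j = fam_at psi j) -> phi = psi.
Proof. by move=> e; apply: component_inj => -[[] j]; apply: e. Qed.

Lemma fam_at_tr W V U (phi : pro_fam W V U) i j (h : dir_le i j) :
  alg_comp (tens_map (alg_id V) (pro_tr U h)) (fam_at phi j) = fam_at phi i.
Proof.
exact: (@component_tr Alg W (pro_bobj tens (cst V) U) phi (tt, i) (tt, j)
  (conj I h)).
Qed.

Section FamCone.
Variables (W V : comodule H) (U : pro_obj Alg).
Variable t : forall j, alg_hom W (tens_alg V (U j)).
Hypothesis t_tr : forall i j (h : dir_le i j),
  alg_comp (tens_map (alg_id V) (pro_tr U h)) (t j) = t i.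
Let t' (j : pro_idx (pro_bobj tens (cst V) U)) :
  @mor Alg W (pro_bobj tens (cst V) U j) := t j.2.
Lemma fam_cone_tr i j (h : dir_le i j) :
  pro_tr (pro_bobj tens (cst V) U) h ∘ t' j = t' i.
Proof. exact: t_tr. Qed.
Definition fam_cone : pro_fam W V U := cone fam_cone_tr.
Lemma fam_at_cone j : fam_at fam_cone j = t j.
Proof. exact: (component_cone fam_cone_tr (tt, j)). Qed.
End FamCone.

Lemma represents_fam_at W V U (phi : pro_fam W V U) j :
  @represents Alg (cst W) (pro_bobj tens (cst V) U) phi (tt, j) tt
    (fam_at phi j).
Proof. exact: represents_component. Qed.

Definition fam_push W V U U' (u : pro_hom U U') (phi : pro_fam W V U) :
    pro_fam W V U' :=
  bimap ptens (idm (cst V)) (u : @mor (pro_cat Alg) U U') ∘ phi.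

Lemma fam_at_push W V U U' (u : pro_hom U U') (phi : pro_fam W V U) j i
    (t : alg_hom (U i) (U' j)) :
  @represents Alg U U' u j i t ->
  fam_at (fam_push u phi) j = alg_comp (tens_map (alg_id V) t) (fam_at phi i).
Proof.
move=> ut; apply: (@component_eq Alg W (pro_bobj tens (cst V) U') _ (tt, j) tt).
apply: (@represents_comp Alg (cst W) (pro_bobj tens (cst V) U)
  (pro_bobj tens (cst V) U') _ phi (tt, j) (tt, i) tt
  (tens_map (alg_id V) t) (fam_at phi i)); last exact: represents_fam_at.
exact: (@represents_bimap Alg Alg Alg tens (cst V) (cst V) U U' _ u
  tt tt i j (alg_id V) t (represents_id _) ut).
Qed.

Definition fam_pull W W' V V' U (g : com_hom W W') (f : com_hom V' V)
    (phi : pro_fam W' V' U) : pro_fam W V U :=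
  bimap ptens (fmap (pro_unit Alg) (com_fun f : @mor Alg _ _))
    (idm (U : pro_cat Alg)) ∘ phi
    ∘ fmap (pro_unit Alg) (com_fun g : @mor Alg _ _).

Lemma fam_at_pull W W' V V' U (g : com_hom W W') (f : com_hom V' V)
    (phi : pro_fam W' V' U) j :
  fam_at (fam_pull g f phi) j =
  alg_comp (alg_comp (tens_map f (alg_id (U j))) (fam_at phi j)) g.
Proof.
apply: (@component_eq Alg W (pro_bobj tens (cst V) U) _ (tt, j) tt).
apply: (@represents_comp Alg (cst W) (cst W') (pro_bobj tens (cst V) U)
  _ _ (tt, j) tt tt (alg_comp (tens_map f (alg_id (U j))) (fam_at phi j)) g);
  last exact: represents_const.
apply: (@represents_comp Alg (cst W') (pro_bobj tens (cst V') U)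
  (pro_bobj tens (cst V) U) _ phi (tt, j) (tt, j) tt
  (tens_map f (alg_id (U j))) (fam_at phi j)); last exact: represents_fam_at.
exact: (@represents_bimap Alg Alg Alg tens (cst V') (cst V) U U _ _
  tt tt j j f (alg_id _) (represents_const _ _ _) (represents_id _)).
Qed.

Lemma represents_coact V :
  @represents Alg (cst V) (pro_bobj tens (cst V) (cst H)) (pro_coact V)
    (tt, tt) tt (coact V).
Proof.
rewrite -[coact V in X in represents _ X]alg_comp_idl.
apply: (@represents_comp Alg (cst V) (cst (tens (V : Alg, H : Alg)))
  (pro_bobj tens (cst V) (cst H)) _ _ (tt, tt) tt tt (alg_id _) (coact V)).
  by [].
exact: represents_const.
Qed.

Lemma represents_flip U j :
  @represents Alg (pro_bobj tens (cst H) U) (pro_bobj tens U (cst H))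
    (pro_flip (cst H) U) (j, tt) (tt, j) (tens_flip H (U j)).
Proof. by []. Qed.

(** Every arrow of the diagram defining pro-families is represented, at each
    index, by the corresponding arrow of the diagram defining families. *)
Lemma is_pro_familyP W V U (phi : pro_fam W V U) :
  is_pro_family phi <-> forall j, is_family (fam_at phi j).
Proof.
have L j : @represents Alg (cst W) (ptens (cst V, ptens (U, cst H)))
    (bimap ptens (idm (cst V)) (pro_flip (cst H) U) ∘ pro_assoc (cst V) (cst H) U
    ∘ bimap ptens (pro_coact V) (idm (U : pro_cat Alg)) ∘ phi) (tt, (j, tt)) tt
    (bimap tens (idm (V : Alg)) (tens_flip H (U j)) ∘ tens_assoc V H (U j)
    ∘ bimap tens (coact V) (idm (U j : Alg)) ∘ fam_at phi j).
  apply: (@represents_comp Alg (cst W) (pro_bobj tens (cst V) U)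
    (ptens (cst V, ptens (U, cst H))) _ phi (tt, (j, tt)) (tt, j) tt _
    (fam_at phi j)); last exact: represents_fam_at.
  apply: (@represents_comp Alg (pro_bobj tens (cst V) U)
    (ptens (ptens (cst V, cst H), U)) (ptens (cst V, ptens (U, cst H))) _ _
    (tt, (j, tt)) ((tt, tt), j) (tt, j)).
    apply: (@represents_comp Alg (ptens (ptens (cst V, cst H), U))
      (ptens (cst V, ptens (cst H, U))) (ptens (cst V, ptens (U, cst H))) _ _
      (tt, (j, tt)) (tt, (tt, j)) ((tt, tt), j)); last by [].
    exact: (@represents_bimap Alg Alg Alg tens (cst V) (cst V)
      (ptens (cst H, U)) (ptens (U, cst H)) _ _ tt tt (tt, j) (j, tt)
      (alg_id V) (tens_flip H (U j)) (represents_id _) (represents_flip j)).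
  exact: (@represents_bimap Alg Alg Alg tens (cst V) (ptens (cst V, cst H)) U U
    _ _ tt (tt, tt) j j _ (alg_id _) (represents_coact V) (represents_id _)).
have R j : @represents Alg (cst W) (ptens (cst V, ptens (U, cst H)))
    (pro_assoc (cst V) U (cst H) ∘ bimap ptens phi (idm (cst H)) ∘ pro_coact W)
    (tt, (j, tt)) tt
    ((tens_assoc V (U j) H : @mor Alg _ _)
    ∘ bimap tens (fam_at phi j) (idm (H : Alg)) ∘ coact W).
  apply: (@represents_comp Alg (cst W) (ptens (cst W, cst H))
    (ptens (cst V, ptens (U, cst H))) _ _ (tt, (j, tt)) (tt, tt) tt);
    last exact: represents_coact.
  apply: (@represents_comp Alg (ptens (cst W, cst H))
    (ptens (ptens (cst V, U), cst H)) (ptens (cst V, ptens (U, cst H))) _ _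
    (tt, (j, tt)) ((tt, j), tt) (tt, tt)); first by [].
  exact: (@represents_bimap Alg Alg Alg tens (cst W) (ptens (cst V, U)) (cst H)
    (cst H) _ _ tt (tt, j) tt tt _ (alg_id H) (represents_fam_at phi j)
    (represents_id _)).
split=> [e j|e].
  by rewrite /is_family -(component_eq (L j)) -(component_eq (R j)) e.
apply: component_inj => -[[] [j []]].
by rewrite (component_eq (L j)) (component_eq (R j)) e.
Qed.
End ProFamilies.

(** * The pro-algebra of the universal family *)

Section Support.
Variable T : eqType.
Lemma seq_directed (s t : seq T) :
  exists r : seq T, {subset s <= r} /\ {subset t <= r}.
Proof.
by exists (s ++ t); split=> x xs; rewrite mem_cat xs ?orbT.
Qed.
(** A finite sequence stands for the subspace it spans; comparing members instead
    of spans gives a directed preorder all the same. *)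
Definition dir_seq : directed_set :=
  @DirectedSet (seq T) (fun s t : seq T => {subset s <= t}) (fun s x xs => xs)
    (fun s t r st tr x xs => tr x (st x xs)) (inhabits [::]) seq_directed.
End Support.

Section RepSystem.
Variables (K : fieldType) (H : hopf_algebra K) (W V : comodule H).
Variables (I : finType) (g : I -> W).
Hypothesis g_gen : generating g.

Local Notation Alg := (alg_cat K).
Local Notation rep := (@rep_alg K H W V I g).
Local Notation fam s := (rep_family s g_gen).

Lemma adapted_sub s t (U : algebra K) (phi : alg_hom W (tens_alg V U)) :
  {subset s <= t} -> adapted g s phi -> adapted g t phi.
Proof. by move=> st [pf ps]; split=> // i; apply: supported_sub st (ps i). Qed.

Lemma rep_hom_eq s (U : algebra K) (f f' : alg_hom (rep s) U) :
  alg_comp (tens_map (alg_id V) f) (fam s) =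
  alg_comp (tens_map (alg_id V) f') (fam s) -> f = f'.
Proof.
move=> e; have [h [_ h_uniq]] := rep_universal g_gen
  (adapted_push f (rep_family_adapted s g_gen)).
by rewrite -(h_uniq _ erefl) -(h_uniq _ e).
Qed.

(** The universal family supported on [s] is supported on [t] as well, hence is
    induced from the universal one there. *)
Definition rep_tr s t (st : {subset s <= t}) : alg_hom (rep t) (rep s) :=
  rep_lift (adapted_sub st (rep_family_adapted s g_gen)).

Lemma rep_trE s t (st : {subset s <= t}) :
  alg_comp (tens_map (alg_id V) (rep_tr st)) (fam t) = fam s.
Proof. exact: rep_familyE. Qed.

Lemma tens_mapr_comp (A B C : algebra K) (f' : alg_hom B C) (f : alg_hom A B) :
  tens_map (alg_id V) (alg_comp f' f) =
  alg_comp (tens_map (alg_id V) f') (tens_map (alg_id V) f).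
Proof. by rewrite -tens_map_comp alg_comp_idl. Qed.

Lemma rep_tr_id s (ss : {subset s <= s}) : rep_tr ss = alg_id (rep s).
Proof. by apply: rep_hom_eq; rewrite rep_trE tens_map_id alg_comp_idl. Qed.

Lemma rep_tr_comp s t r (st : {subset s <= t}) (tr : {subset t <= r})
    (sr : {subset s <= r}) : alg_comp (rep_tr st) (rep_tr tr) = rep_tr sr.
Proof.
by apply: rep_hom_eq; rewrite tens_mapr_comp -alg_comp_assoc !rep_trE.
Qed.

Definition rep_system : pro_obj (alg_fg_cat K) :=
  @ProObj (alg_fg_cat K) (dir_seq V)
    (fun s => exist _ (rep s) (rep_fin_gen s g_gen)) rep_tr rep_tr_id rep_tr_comp.

Local Notation sys := (pro_fobj (@full_incl Alg (@fin_gen K)) rep_system).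

Definition rep_system_family : pro_fam W V sys :=
  @fam_cone K H W V sys (fun s => fam s) rep_trE.

Lemma rep_system_family_at s : fam_at rep_system_family s = fam s.
Proof. exact: fam_at_cone. Qed.

Lemma supported_finite (U : algebra K) (phi : alg_hom W (tens_alg V U)) :
  exists s, forall i, supported s (phi (g i)).
Proof.
pose s i := sval (cid (supported_exists (phi (g i)))).
have sP i : supported (s i) (phi (g i)) by rewrite /s; case: cid.
exists (flatten [seq s i | i <- enum I]) => i.
apply: supported_sub (sP i) => v vs; apply/flattenP; exists (s i) => //.
by apply: map_f; rewrite mem_enum.
Qed.

(** Composed with the transition maps from a common later term of the system, the
    two morphisms induce the same family, hence agree there by the uniqueness
    in [rep_universal]. *)
Lemma rep_germ_eq (U : algebra K) s t (f : alg_hom (rep s) U)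
    (f' : alg_hom (rep t) U) :
  alg_comp (tens_map (alg_id V) f) (fam s) =
  alg_comp (tens_map (alg_id V) f') (fam t) ->
  @germ_of Alg sys U s f = @germ_of Alg sys U t f'.
Proof.
move=> e; apply/germ_eqP; have [r [sr tr]] := seq_directed s t.
exists r, sr, tr; apply: rep_hom_eq.
rewrite [LHS](congr1 (fun x => alg_comp x _) (tens_mapr_comp f (rep_tr sr))).
rewrite [RHS](congr1 (fun x => alg_comp x _) (tens_mapr_comp f' (rep_tr tr))).
by rewrite -!alg_comp_assoc !rep_trE.
Qed.

(** Each component of a pro-family factors through some term of the system, and
    by [rep_germ_eq] the choice of that term does not affect the germ. *)
Lemma rep_system_universal (U : pro_obj Alg) (phi : pro_fam W V U) :
  is_pro_family phi ->
  exists! u : pro_hom sys U, phi = fam_push u rep_system_family.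
Proof.
move=> /is_pro_familyP fam_phi.
have lift_exists j : exists s (f : alg_hom (rep s) (U j)),
    fam_at phi j = alg_comp (tens_map (alg_id V) f) (fam s).
  have [s ss] := supported_finite (fam_at phi j).
  have [f [e _]] := rep_universal g_gen (conj (fam_phi j) ss).
  by exists s, f.
pose lvl j := projT1 (cid (lift_exists j)).
pose lift j : alg_hom (rep (lvl j)) (U j) :=
  projT1 (cid (projT2 (cid (lift_exists j)))).
have liftE j :
    fam_at phi j = alg_comp (tens_map (alg_id V) (lift j)) (fam (lvl j)).
  exact: projT2 (cid (projT2 (cid (lift_exists j)))).
pose germ_at j := @germ_of Alg sys (U j) (lvl j) (lift j).
have germ_at_tr i j (h : dir_le i j) :
    germ_push (pro_tr U h) (germ_at j) = germ_at i.
  rewrite germ_pushE; apply: rep_germ_eq.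
  rewrite -liftE -(fam_at_tr phi h) liftE alg_comp_assoc.
  by congr alg_comp; apply: tens_mapr_comp.
exists (ProHom germ_at_tr); split.
  apply: fam_at_inj => j.
  rewrite (@fam_at_push K H W V sys U (ProHom germ_at_tr) _ j (lvl j) (lift j)
    erefl).
  by rewrite rep_system_family_at.
move=> u e; apply: pro_homP => j.
have [s [t ut]] := represents_exists u j.
rewrite ut; apply: rep_germ_eq; rewrite -liftE e.
by rewrite (fam_at_push _ ut) rep_system_family_at.
Qed.
End RepSystem.

(** * The mapping functor of finitely generated comodules *)

Section ProFinite.
Variables (K : fieldType) (H : hopf_algebra K).

Local Notation Alg := (alg_cat K).
Local Notation tens := (tens_functor K).
Local Notation ptens := (pro_tens_functor K).
Local Notation cst A := (pro_unit Alg A).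
Local Notation X := (prod_cat (com_fg_cat H) (op_cat (com_cat H))).

Let F (x : X) (U : pro_cat Alg) : Type := pro_fam (sval x.1) x.2 U.
Let push (x : X) (U U' : pro_cat Alg) (u : mor U U') (p : F x U) : F x U' :=
  fam_push u p.
Let pull (x y : X) (U : pro_cat Alg) (m : mor x y) (p : F y U) : F x U :=
  fam_pull m.1 m.2 p.
Let good (x : X) (U : pro_cat Alg) (p : F x U) : Prop := is_pro_family p.

Lemma pro_universal_exists (x : X) :
  exists (a : pro_cat (alg_fg_cat K)) (h : F x (pro_fg_incl K a)),
  universal_element (J := pro_fg_incl K) push good h.
Proof.
case: x => -[W Wfg] V; have [s sW] := Wfg.
pose g (i : 'I_(size s)) : com_alg W := s`_i.
have gen : generating g.
  move=> P P1 PL PM Pg; apply: sW => // x /(nthP 0)[i i_lt <-].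
  exact: (Pg (Ordinal i_lt)).
exists (rep_system V gen), (rep_system_family V gen); split.
  apply/is_pro_familyP => t; rewrite rep_system_family_at.
  exact: (rep_family_adapted t gen).1.
move=> U p fam; exact: rep_system_universal.
Qed.

Lemma pro_mapping_functor :
  exists (A : functor X (pro_cat (alg_fg_cat K)))
      (h : forall (W : com_fg_cat H) (V : com_cat H),
         @mor (pro_cat Alg) (cst (com_alg (sval W)))
           (ptens (cst (com_alg V), pro_fg_incl K (A (W, V))))),
    universal_pro_families h /\ natural_pro_families h /\
    let M : functor (prod_cat (op_cat (gscheme_cat H)) (gscheme_fd_cat H))
              (ind_scheme_cat K) := induced_op A in
    natural_bijection (gmaps_fd H) (functor_comp (ind_points K) M).
Proof.
have push_id x U (p : F x U) : push (idm U) p = p.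
  by rewrite /push /fam_push bimap_id comp_idl.
have push_comp x U U' U'' (u' : mor U' U'') (u : mor U U') (p : F x U) :
    push (u' ∘ u) p = push u' (push u p).
  by rewrite /push /fam_push comp_assoc -bimap_comp comp_idl.
have pull_id x U (p : F x U) : pull (idm x) p = p.
  apply: fam_at_inj => j; rewrite fam_at_pull.
  by apply: alg_homP => w; rewrite !alg_compE tens_map_id.
have pull_comp x y z U (m' : mor y z) (m : mor x y) (p : F z U) :
    pull (m' ∘ m) p = pull m (pull m' p).
  apply: fam_at_inj => j; rewrite !fam_at_pull.
  by apply: alg_homP => w; rewrite !alg_compE tens_map_compE.
have pull_push x y U U' (m : mor x y) (u : mor U U') (p : F y U) :
    pull m (push u p) = push u (pull m p).
  apply: fam_at_inj => j; have [i [t ut]] := represents_exists u j.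
  rewrite fam_at_pull !(fam_at_push _ ut) fam_at_pull.
  apply: alg_homP => w; rewrite !alg_compE !tens_map_compE.
  by rewrite !alg_comp_idl !alg_comp_idr.
have good_pull x y U (m : mor x y) (p : F y U) : good p -> good (pull m p).
  move=> /is_pro_familyP gp; apply/is_pro_familyP => j.
  by rewrite fam_at_pull; apply: family_pull.
have good_push x U U' (u : mor U U') (p : F x U) : good p -> good (push u p).
  move=> /is_pro_familyP gp; apply/is_pro_familyP => j.
  have [i [t ut]] := represents_exists u j.
  by rewrite (fam_at_push _ ut); apply: family_push.
have [A [h [hU hN]]] := universal_functor (J := pro_fg_incl K)
  (@pro_functor_incl_ff _ _)
  push_id push_comp pull_id pull_comp pull_push good_pull pro_universal_exists.
exists A, (fun W V => h (W, V)); split; first by move=> W V; exact: (hU (W, V)).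
split; first by move=> W W' V V' g f; exact: (hN (W, V) (W', V') (g, f)).
move=> M.
pose G (x : X) : Type := com_hom (sval x.1) x.2.
pose Gmap (x y : X) (m : mor x y) (t : G y) : G x :=
  com_comp m.2 (com_comp t m.1).
pose k : pro_cat Alg := pro_unit Alg (ground K).
pose c0 (x : X) (f : alg_hom (sval x.1) x.2) : F x k :=
  @fam_cone K H _ _ (k : pro_obj Alg)
    (fun _ => alg_comp (tens_inl (com_alg x.2) (ground K)) f)
    (fun _ _ _ => etrans (congr1 (fun e => alg_comp e _) (tens_map_id _ _))
       (alg_comp_idl _)).
have c0E x f j :
    fam_at (c0 x f) j = alg_comp (tens_inl (com_alg x.2) (ground K)) f.
  exact: fam_at_cone.
pose c (x : X) (t : G x) : F x k := c0 x (com_fun t).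
have c_good x t : good (c x t).
  apply/is_pro_familyP => j; rewrite c0E.
  by apply/family_inl => w; apply: com_hom_coact.
have c_inj x : injective (c x).
  move=> t t' e; apply/com_homP/alg_homP => w.
  rewrite -[LHS]tens_runit_inl -[RHS]tens_runit_inl; congr (alg_fun _ _).
  by rewrite -!alg_compE -!(c0E x _ tt) -/(c x t) e.
have c_surj x (p : F x k) : good p -> exists t, c x t = p.
  move=> /is_pro_familyP gp; pose f := alg_comp (tens_runit _) (fam_at p tt).
  have ef : alg_comp (tens_inl _ (ground K)) f = fam_at p tt.
    by apply: alg_homP => w; rewrite !alg_compE tens_inl_runit.
  have fC w : coact _ (f w) = tens_map f (alg_id H) (coact _ w).
    by apply/family_inl: w; rewrite ef; apply: gp.
  by exists (ComHom fC); apply: fam_at_inj => -[]; rewrite c0E.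
have c_nat x y (m : mor x y) t : c x (Gmap x y m t) = pull m (c y t).
  apply: fam_at_inj => j; rewrite fam_at_pull !c0E; apply: alg_homP => w.
  by symmetry; apply: tens_mapE.
have [b [b_bij b_nat]] := universal_bijection push_comp pull_push good_push
  hU hN c_good c_inj c_surj c_nat.
exists (fun S => b (S.2, S.1)); split=> [S|S S' f t]; first exact: b_bij.
rewrite -[RHS](b_nat (S'.2, S'.1) (S.2, S.1) (f.2, f.1)).
congr (b _ _); apply: com_homP; exact: alg_homP.
Qed.
End ProFinite.

Theorem corollary4p3 (K : fieldType) (H : hopf_algebra K) :
  (exists (A : functor (prod_cat (com_cat H) (op_cat (com_fd_cat H)))
                 (alg_cat K))
      (h : forall (W : com_cat H) (V : com_fd_cat H),
         @mor (alg_cat K) (com_alg W)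
           (tens_functor K (com_alg (sval V), A (W, V)))),
    universal_families h /\ natural_families h /\
    let M : functor (prod_cat (op_cat (gscheme_fnt_cat H)) (gscheme_cat H))
              (scheme_cat K) := induced_op A in
    natural_bijection (gmaps_fnt H) (functor_comp (points K) M))
  /\
  (exists (A : functor (prod_cat (com_fg_cat H) (op_cat (com_cat H)))
                 (pro_cat (alg_fg_cat K)))
      (h : forall (W : com_fg_cat H) (V : com_cat H),
         @mor (pro_cat (alg_cat K)) (pro_unit (alg_cat K) (com_alg (sval W)))
           (pro_tens_functor K
              (pro_unit (alg_cat K) (com_alg V), pro_fg_incl K (A (W, V))))),
    universal_pro_families h /\ natural_pro_families h /\
    let M : functor (prod_cat (op_cat (gscheme_cat H)) (gscheme_fd_cat H))
              (ind_scheme_cat K) := induced_op A in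
    natural_bijection (gmaps_fd H) (functor_comp (ind_points K) M)).
Proof. by split; [exact: finite_mapping_functor|exact: pro_mapping_functor]. Qed.
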